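(* For any matrix $A\in\mathbb{R}^{m\times n}$ and constant $p \in\mathbb{Q}\cap(2, \infty)$, $\|A\|_{p_u}$ can be obtained by the optimal value of problem (P) below such that $$ \|A\|_{p_u}\le \|A\|_{p_*}\le {\delta_G}\|A\|_{p_u}. $$ Moreover, any optimal solution $Z\in\mathbb{R}^{m\times n}$ of (P) is an approximate dual certificate of $\|A\|_{p_*}$ in the sense that $$ \|Z\|_{p_\sigma}\le 1 \text{ and } \langle A,Z\rangle\ge \|A\|_{p_*}/\delta_G. $$ Here (P) is the conic optimization problem $$ \begin{array}{ll} \max & \langle A,Z\rangle \\ \textnormal{s.t.} & u_1+ u_2+\theta_p\sum_{i=1}^{m+n} t_i\le 1\\ & (v_i, u_1,t_i)\in\mathbb{K}^3_p\quad i=1,2,\dots, m \\ & (v_i, u_2,t_i)\in\mathbb{K}^3_p\quad i=m+1,m+2,\dots, m+n\\ & D(\boldsymbol{v})\succeq \begin{pmatrix} O & Z/2 \\ Z^{\textnormal{T}}/2 & O\end{pmatrix}, \end{array} $$ with variables $Z\in\mathbb{R}^{m\times n}$, $u_1,u_2\in\mathbb{R}$, $\boldsymbol{v},\boldsymbol{t}\in\mathbb{R}^{m+n}$.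
   Context: For $p\in[1,\infty]$ let $q$ satisfy $\frac1p+\frac1q=1$. For a matrix $A\in\mathbb{R}^{m\times n}$, the spectral $p$-norm is $\|A\|_{p_\sigma}=\max\{\boldsymbol{x}^{\textnormal{T}}A\boldsymbol{y}:\|\boldsymbol{x}\|_p=\|\boldsymbol{y}\|_p=1\}$ and the nuclear $p$-norm is $\|A\|_{p_*}=\min\{\sum_{i=1}^r|\lambda_i|: A=\sum_{i=1}^r\lambda_i\boldsymbol{x}_i\boldsymbol{y}_i^{\textnormal{T}},\ \|\boldsymbol{x}_i\|_p=\|\boldsymbol{y}_i\|_p=1,\ r\in\mathbb{N}\}$; these norms are dual to each other. Define $$ \|A\|_{p_v}:= \max \left\{\left\langle \begin{pmatrix} O & A/2 \\ A^{\textnormal{T}}/2 & O \end{pmatrix}, X\right\rangle: \sum_{i=1}^m|x_{i i}|^{p/2} \le 1,\ \sum_{i=m+1}^{m+n}|x_{ii}|^{p/2} \le 1,\ X \succeq O\right\} $$ and $\|A\|_{p_u}:=\max\{\langle A,Z\rangle:\|Z\|_{p_v}\le 1\}$. $\delta_G$ is the Grothendieck constant. $D(\boldsymbol{v})$ denotes the diagonal matrix with diagonal $\boldsymbol{v}$. $\theta_p:=(2/p)^{2/(p-2)}-(2/p)^{p/(p-2)}>0$. $\mathbb{K}^3_p:=\{(u,v,t)\in\mathbb{R}_+^3:v^{p/(p-2)}\le t u^{2/(p-2)}\}$; in (P) the membership ''$(v_i,u_1,t_i)\in\mathbb{K}^3_p$'' is used to mean $u_1,v_i,t_i\ge0$ and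 $v_i^{p/(p-2)}\le t_i u_1^{2/(p-2)}$ (and similarly with $u_2$). $\mathbb{K}^3_p$ is second-order cone representable, so (P) is a polynomial-size SDP. *)

(* Defs.v *)
From HB Require Import structures.
From mathcomp Require Import all_boot all_order all_algebra.
From mathcomp Require Import all_classical all_reals exp.
Set Implicit Arguments. Unset Strict Implicit. Unset Printing Implicit Defensive.
Import Order.TTheory GRing.Theory Num.Theory.
Local Open Scope ring_scope.
Local Open Scope classical_set_scope.

Section Defs.
Variable R : realType.

Definition frob {m n : nat} (A B : 'M[R]_(m, n)) : R :=
  \sum_(i < m) \sum_(j < n) A i j * B i j.

Definition pnorm (p : R) {k : nat} (x : 'cV[R]_k) : R :=
  (\sum_(i < k) `|x i 0| `^ p) `^ (p^-1).

Definition psd {k : nat} (M : 'M[R]_k) : Prop :=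
  M^T = M /\ forall x : 'cV[R]_k, 0 <= (x^T *m M *m x) 0 0.

Definition spec_pnorm (p : R) {m n : nat} (A : 'M[R]_(m, n)) : R :=
  sup [set s | exists (x : 'cV[R]_m) (y : 'cV[R]_n),
     pnorm p x = 1 /\ pnorm p y = 1 /\ s = (x^T *m A *m y) 0 0].

Definition nuc_pnorm (p : R) {m n : nat} (A : 'M[R]_(m, n)) : R :=
  inf [set s | exists (r : nat) (lam : 'I_r -> R)
     (x : 'I_r -> 'cV[R]_m) (y : 'I_r -> 'cV[R]_n),
     (forall k, pnorm p (x k) = 1) /\ (forall k, pnorm p (y k) = 1) /\
     A = \sum_(k < r) lam k *: (x k *m (y k)^T) /\
     s = \sum_(k < r) `|lam k|].

Definition sym_block {m n : nat} (A : 'M[R]_(m, n)) : 'M[R]_(m + n) :=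
  block_mx 0 (2^-1 *: A) (2^-1 *: A^T) 0.

Definition v_pnorm (p : R) {m n : nat} (A : 'M[R]_(m, n)) : R :=
  sup [set s | exists X : 'M[R]_(m + n),
     \sum_(i < m) `|X (lshift n i) (lshift n i)| `^ (p / 2) <= 1 /\
     \sum_(j < n) `|X (rshift m j) (rshift m j)| `^ (p / 2) <= 1 /\
     psd X /\ s = frob (sym_block A) X].

Definition u_pnorm (p : R) {m n : nat} (A : 'M[R]_(m, n)) : R :=
  sup [set s | exists Z : 'M[R]_(m, n), v_pnorm p Z <= 1 /\ s = frob A Z].

Definition theta (p : R) : R :=
  (2 / p) `^ (2 / (p - 2)) - (2 / p) `^ (p / (p - 2)).

Definition Kp3 (p : R) (v u t : R) : Prop :=
  0 <= u /\ 0 <= v /\ 0 <= t /\ v `^ (p / (p - 2)) <= t * u `^ (2 / (p - 2)).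

Definition P_feasible (p : R) {m n : nat} (Z : 'M[R]_(m, n)) (u1 u2 : R)
    (v t : 'rV[R]_(m + n)) : Prop :=
  u1 + u2 + theta p * \sum_(i < m + n) t 0 i <= 1 /\
  (forall i : 'I_m, Kp3 p (v 0 (lshift n i)) u1 (t 0 (lshift n i))) /\
  (forall j : 'I_n, Kp3 p (v 0 (rshift m j)) u2 (t 0 (rshift m j))) /\
  psd (diag_mx v - sym_block Z).

Definition P_value (p : R) {m n : nat} (A : 'M[R]_(m, n)) : R :=
  sup [set s | exists Z u1 u2 v t, P_feasible p Z u1 u2 v t /\ s = frob A Z].

Definition P_optimal (p : R) {m n : nat} (A : 'M[R]_(m, n))
    (Z : 'M[R]_(m, n)) (u1 u2 : R) (v t : 'rV[R]_(m + n)) : Prop :=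
  P_feasible p Z u1 u2 v t /\ frob A Z = P_value p A.

Definition sign_max {m n : nat} (A : 'M[R]_(m, n)) : R :=
  sup [set s | exists (e : 'I_m -> R) (f : 'I_n -> R),
     (forall i, e i = 1 \/ e i = -1) /\ (forall j, f j = 1 \/ f j = -1) /\
     s = \sum_(i < m) \sum_(j < n) A i j * e i * f j].

Definition grothendieck_const : R :=
  inf [set K | forall (m n d : nat) (A : 'M[R]_(m, n))
     (x : 'I_m -> 'rV[R]_d) (y : 'I_n -> 'rV[R]_d),
     (forall i, (x i *m (x i)^T) 0 0 = 1) ->
     (forall j, (y j *m (y j)^T) 0 0 = 1) ->
     \sum_(i < m) \sum_(j < n) A i j * (x i *m (y j)^T) 0 0 <= K * sign_max A].

End Defs.

(* Main.v *)
(* The dual of the constraint max(||d1||_{p/2}, ||d2||_{p/2}) <= 1 on the two halves of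
   the diagonal of X is ||v1||_q + ||v2||_q <= 1 with q = p/(p-2), and by Young's
   inequality the cone constraints of (P) express exactly this; conic duality, obtained
   from a Hahn-Banach sandwich theorem, then gives that Z is feasible for (P) iff
   ||Z||_{p_v} <= 1.  Rank one X = (x;y)(x;y)^T give ||Z||_{p_sigma} <= ||Z||_{p_v}, so
   the u-norm is at most the nuclear norm.  Conversely, let Z be a functional supporting
   the nuclear norm at A: writing X as a Gram matrix, <sym_block Z, X> is a Grothendieck
   sum, and rounding it to signs produces matrices x y^T of nuclear norm at most 1, so
   that Z / delta_G is admissible for the u-norm. *)
Require Import Defs.
From HB Require Import structures.
From mathcomp Require Import all_boot all_order all_algebra.
From mathcomp Require Import all_classical all_reals exp.
From mathcomp Require Import ring lra.
Import Order.TTheory GRing.Theory Num.Theory.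
Local Open Scope ring_scope.

(** All norms here are [sup] or [inf] of sets of reals, which default to 0 when the set is empty or
    unbounded, so nonemptiness and boundedness have to be proved each time. For [grothendieck_const]
    this amounts to Grothendieck's inequality itself, with some finite constant; any constant would
    serve, and 128 comes out of a truncation argument. No maximum is shown to be attained: (P) and
    the u-norm are suprema over the same set of [Z]. Separation works in finite dimension without
    Zorn's lemma, since linearity along the finitely many matrix units already produces a matrix. *)

(** * Sublinear functionals and the sandwich theorem *)

Record sublinear {R : realType} {V : lmodType R} (p : V -> R) : Prop := {
  sublinear0 : p 0 = 0;
  sublinearD : forall x y, p (x + y) <= p x + p y;
  sublinearZ : forall t x, 0 < t -> p (t *: x) <= t * p x }.

(** A convex cone of lower bounds [s] prescribed at [c]. It is a relation because one vector may
    carry several values: many psd matrices share a diagonal. *)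
Record graph_cone {R : realType} {V : lmodType R} (C : V -> R -> Prop) : Prop := {
  graph_cone0 : C 0 0;
  graph_coneD : forall c s c' s', C c s -> C c' s' -> C (c + c') (s + s');
  graph_coneZ : forall t c s, 0 < t -> C c s -> C (t *: c) (t * s) }.

(* The witness is [q x = inf (p (x + c) - s)] over the [(c, s)] of the cone. *)
Lemma sublinear_sandwich {R : realType} {V : lmodType R} (p : V -> R)
    (C : V -> R -> Prop) :
  sublinear p -> graph_cone C -> (forall c s, C c s -> s <= p c) ->
  exists q : V -> R, [/\ sublinear q, forall x, q x <= p x
    & forall c s, C c s -> q (- c) <= - s].
Proof.
move=> [p0 pD pZ] [C0 CD CZ] Cp.
pose S x := [set z | exists c s, C c s /\ z = p (x + c) - s]%classic.
(* A lower bound independent of [c] and [s] makes the infimum genuine. *)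
have Slb x c s : C c s -> - p (- x) <= p (x + c) - s.
  move=> Ccs; have := Cp _ _ Ccs; have := pD (x + c) (- x).
  rewrite addrAC subrr add0r; lra.
have q_le x c s : C c s -> inf (S x) <= p (x + c) - s.
  move=> Ccs; apply: ge_inf; last by exists c, s.
  by exists (- p (- x)) => z [c' [s' [C' ->]]]; exact: Slb.
have le_q x b : (forall c s, C c s -> b <= p (x + c) - s) -> b <= inf (S x).
  move=> h; apply: lb_le_inf; first by exists (p (x + 0) - 0), 0, 0.
  by move=> z [c [s [Ccs ->]]]; exact: h.
exists (fun x => inf (S x)); split; first split.
- apply/eqP; rewrite eq_le; apply/andP; split.
    by apply: le_trans (q_le _ _ _ C0) _; rewrite addr0 p0 subr0.
  by apply: le_q => c s /Cp; rewrite add0r subr_ge0.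
- move=> x y; rewrite -lerBlDr; apply: (le_q x) => c s Ccs.
  rewrite lerBlDr -lerBlDl; apply: le_q => c' s' Ccs'.
  have := q_le (x + y) _ _ (CD _ _ _ _ Ccs Ccs'); have := pD (x + c) (y + c').
  by rewrite addrACA; lra.
- move=> t x t0; rewrite mulrC -ler_pdivrMr//; apply: le_q => c s Ccs.
  rewrite ler_pdivrMr//; apply: le_trans (q_le _ _ _ (CZ _ _ _ t0 Ccs)) _.
  by rewrite -scalerDr; have := pZ t (x + c) t0; lra.
- by move=> x; have := q_le x _ _ C0; rewrite addr0 subr0.
(* At [- c] the pair [(c, s)] itself contributes [p 0 - s]. *)
- by move=> c s Ccs; have := q_le (- c) _ _ Ccs; rewrite addNr p0 sub0r.
Qed.

Lemma sublinear_le_scale {R : realType} {V : lmodType R} (p : V -> R) t x :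
  sublinear p -> 0 <= t -> t * p x <= p (t *: x).
Proof.
move=> sp; rewrite le_eqVlt => /predU1P[<-|t0].
  by rewrite mul0r scale0r (sublinear0 _ sp).
have := sublinearZ _ sp t^-1 (t *: x); rewrite invr_gt0 => /(_ t0).
by rewrite scalerA mulVf ?gt_eqF// scale1r ler_pdivlMl.
Qed.

(* Sandwiching along the ray of [a] makes the functional linear along [a]. *)
Lemma sublinear_linear_along {R : realType} {V : lmodType R} (p : V -> R) (s : seq V) :
  sublinear p -> exists q : V -> R, [/\ sublinear q, forall x, q x <= p x
    & forall a, a \in s -> q (- a) <= - q a].
Proof.
move=> sp; elim: s => [|a s [q [sq qp qs]]]; first by exists p; split.
pose C c r := exists t, [/\ 0 <= t, c = t *: a & r = t * q a].
have [||q' [sq' q'q q'C]] := sublinear_sandwich q C sq.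
- split.
  + by exists 0; rewrite scale0r mul0r.
  + move=> c r c' r' [t [t0 -> ->]] [t' [t'0 -> ->]]; exists (t + t').
    by rewrite addr_ge0 // scalerDl mulrDl.
  + move=> t c r t0 [t' [t'0 -> ->]]; exists (t * t').
    by rewrite scalerA mulrA mulr_ge0 // ltW.
- by move=> c r [t [t0 -> ->]]; exact: sublinear_le_scale.
exists q'; split=> // [x|b]; first exact: le_trans (q'q x) (qp x).
rewrite inE => /predU1P[->|bs].
  have /q'C h : C a (q a) by exists 1; rewrite scale1r mul1r.
  by apply: le_trans h _; rewrite lerN2.
(* Lowering the functional keeps the earlier directions:
   [q' (- b) <= q (- b) <= - q b <= - q' b]. *)
by apply: le_trans (q'q _) _; apply: le_trans (qs b bs) _; rewrite lerN2.
Qed.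

(** * The trace pairing and separation for matrices *)

Lemma frobDr {R : realType} {m n : nat} (A B C : 'M[R]_(m, n)) :
  frob A (B + C) = frob A B + frob A C.
Proof.
rewrite /frob -big_split; apply: eq_bigr => i _; rewrite -big_split.
by apply: eq_bigr => j _; rewrite mxE mulrDr.
Qed.

Lemma frobZr {R : realType} {m n : nat} (A B : 'M[R]_(m, n)) c :
  frob A (c *: B) = c * frob A B.
Proof.
rewrite /frob mulr_sumr; apply: eq_bigr => i _; rewrite mulr_sumr.
by apply: eq_bigr => j _; rewrite mxE mulrCA.
Qed.

Lemma frobC {R : realType} {m n : nat} (A B : 'M[R]_(m, n)) : frob A B = frob B A.
Proof. by apply: eq_bigr => i _; apply: eq_bigr => j _; rewrite mulrC. Qed.

Lemma frob0r {R : realType} {m n : nat} (A : 'M[R]_(m, n)) : frob A 0 = 0.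
Proof. by rewrite -(scale0r A) frobZr mul0r. Qed.

Lemma frobNr {R : realType} {m n : nat} (A B : 'M[R]_(m, n)) :
  frob A (- B) = - frob A B.
Proof. by rewrite -scaleN1r frobZr mulN1r. Qed.

Lemma frob_sumr {R : realType} {m n : nat} (A : 'M[R]_(m, n)) {I : finType}
    (F : I -> 'M[R]_(m, n)) : frob A (\sum_i F i) = \sum_i frob A (F i).
Proof.
by apply: (big_morph (frob A)); [exact: frobDr|exact: frob0r].
Qed.

Lemma frobZl {R : realType} {m n : nat} (A B : 'M[R]_(m, n)) c :
  frob (c *: A) B = c * frob A B.
Proof. by rewrite frobC frobZr frobC. Qed.

Lemma frobBl {R : realType} {m n : nat} (A B C : 'M[R]_(m, n)) :
  frob (A - B) C = frob A C - frob B C.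
Proof. by rewrite frobC frobDr frobNr frobC (frobC C). Qed.

Lemma sublinear_sum {R : realType} {V : lmodType R} (p : V -> R) {I : finType}
    (F : I -> V) : sublinear p -> p (\sum_i F i) <= \sum_i p (F i).
Proof.
move=> sp; elim/big_ind2: _ => [|x a y b xa yb|//].
  by rewrite (sublinear0 _ sp).
by apply: le_trans (sublinearD _ sp _ _) _; exact: lerD.
Qed.

(** After the sandwich along [C], the functional is made linear along the matrix units, and [Z]
    collects its values there. Expanding [B] in units gives [q B <= frob Z B], negative coefficients
    being where [q (- a) <= - q a] enters; the same bound at [- B] gives the converse. *)
Lemma matrix_hahn_banach {R : realType} {m n : nat} (p : 'M[R]_(m, n) -> R)
    (C : 'M[R]_(m, n) -> R -> Prop) :
  sublinear p -> graph_cone C -> (forall c s, C c s -> s <= p c) ->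
  exists Z, (forall B, frob Z B <= p B) /\ forall c s, C c s -> s <= frob Z c.
Proof.
move=> sp cC Cp.
have [q1 [sq1 q1p q1C]] := sublinear_sandwich p C sp cC Cp.
pose s := [seq delta_mx i j : 'M[R]_(m, n) | i <- enum 'I_m, j <- enum 'I_n].
have [q [sq qq1 qs]] := sublinear_linear_along q1 s sq1.
pose Z : 'M[R]_(m, n) := \matrix_(i, j) q (delta_mx i j).
have q_le B : q B <= frob Z B.
  rewrite {1}(matrix_sum_delta B); apply: le_trans (sublinear_sum _ _ sq) _.
  apply: ler_sum => i _; apply: le_trans (sublinear_sum _ _ sq) _.
  apply: ler_sum => j _; rewrite mxE mulrC.
  have [Bpos|Bneg|<-] := ltgtP 0 (B i j).
  - exact: (sublinearZ _ sq).
  - have Bn : 0 < - B i j by rewrite oppr_gt0.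
    have := sublinearZ _ sq _ (- delta_mx i j) Bn.
    rewrite scalerN scaleNr opprK => /le_trans; apply.
    have /(ler_wpM2l (ltW Bn)) : q (- delta_mx i j) <= - q (delta_mx i j).
      by apply: qs; apply/allpairsP; exists (i, j); rewrite !mem_enum.
    by rewrite mulrNN.
  - by rewrite scale0r mul0r (sublinear0 _ sq).
have le_q B : frob Z B <= q B.
  have := q_le (- B); rewrite frobNr; have := sublinearD _ sq B (- B).
  by rewrite subrr (sublinear0 _ sq); lra.
exists Z; split => [B|c r Ccr].
  exact: le_trans (le_trans (le_q B) (qq1 B)) (q1p B).
have := le_trans (le_q (- c)) (le_trans (qq1 _) (q1C _ _ Ccr)).
by rewrite frobNr lerN2.
Qed.

(** * Gram factorization of psd matrices *)

Lemma addmxE {R : realType} {m n : nat} (A B : 'M[R]_(m, n)) i j :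
  (A + B) i j = A i j + B i j.
Proof. by rewrite mxE. Qed.

Lemma scalemxE {R : realType} {m n : nat} c (A : 'M[R]_(m, n)) i j :
  (c *: A) i j = c * A i j.
Proof. by rewrite mxE. Qed.

Lemma mul_trmxC {R : realType} {k : nat} (y b : 'cV[R]_k) :
  (y^T *m b) 0 0 = (b^T *m y) 0 0.
Proof. by rewrite -[in LHS](trmxK b) -trmx_mul mxE. Qed.

Lemma quad_block {R : realType} {k : nat} (a s : R) (b y : 'cV[R]_k) (C : 'M[R]_k) :
  ((col_mx s%:M y)^T *m block_mx a%:M b^T b C *m col_mx s%:M y : 'M[R]_1) 0 0
  = a * s ^+ 2 + 2 * s * (b^T *m y) 0 0 + (y^T *m C *m y) 0 0.
Proof.
rewrite tr_col_mx tr_scalar_mx mul_row_block mul_row_col !mulmxDl.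
rewrite -!scalar_mxM !mul_scalar_mx !mul_mx_scalar -!scalemxAl.
rewrite !addmxE !scalemxE mul_trmxC mxE /= mulr1n; ring.
Qed.

(** Cholesky factorization by induction on the Schur complement of the corner [a]. The convention
    that the inverse of 0 is 0 covers a zero pivot, where [b] must vanish. *)
Lemma psd_gram {R : realType} {k : nat} (M : 'M[R]_k) :
  psd M -> exists B : 'M[R]_k, M = B *m B^T.
Proof.
elim: k M => [|k IH] M; first by exists 0; rewrite flatmx0 [RHS]flatmx0.
rewrite -[k.+1]/(1 + k)%N in M *.
move=> [Msym Mpos].
pose a := M 0 0; pose b : 'cV_k := dlsubmx M; pose C : 'M_k := drsubmx M.
have Mblock : M = block_mx a%:M b^T b C.
  rewrite -[LHS]submxK; congr block_mx; last by rewrite /b trmx_dlsub Msym.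
  by rewrite [LHS]mx11_scalar !mxE !lshift0.
have Cpos s (y : 'cV[R]_k) : 0 <= a * s ^+ 2 + 2 * s * (b^T *m y) 0 0 + (y^T *m C *m y) 0 0.
  by have := Mpos (col_mx (s%:M : 'M_1) y); rewrite Mblock quad_block.
have Csym : C^T = C by rewrite /C trmx_drsub Msym.
have a0 : 0 <= a.
  by have := Cpos 1 0; rewrite !mulmx0 mxE expr1n !(mulr1, mulr0, addr0).
have [|B CB] := IH (C - a^-1 *: (b *m b^T)).
  split; first by rewrite linearB linearZ /= trmx_mul trmxK Csym.
  (* For [a > 0] this is the [s] minimising the quadratic form, and the minimum is the form of the
     Schur complement. *)
  move=> y; have := Cpos (- a^-1 * (b^T *m y) 0 0) y.
  rewrite mulmxBr mulmxBl -scalemxAr -scalemxAl mulmxA -[_ *m b^T *m y]mulmxA.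
  rewrite [y^T *m b]mx11_scalar (mul_trmxC y b) mul_scalar_mx.
  rewrite -scaleN1r addmxE !scalemxE.
  set t := (b^T *m y) 0 0; set c := (_ *m y) 0 0.
  have [->|an0] := eqVneq a 0; first by rewrite invr0; lra.
  suff -> : a * (- a^-1 * t) ^+ 2 + 2 * (- a^-1 * t) * t + c =
            c + -1 * (a^-1 * (t * t)) by [].
  by field.
have b0 : a = 0 -> b = 0.
  move=> az; set t := (b^T *m b) 0 0; set c := (b^T *m C *m b) 0 0.
  have t0 : t = 0.
    have [//|tn0] := eqVneq t 0.
    (* With [a = 0] the form is affine in [s]; this [s] gives it the value -1. *)
    have := Cpos (- (c + 1) / (2 * t)) b; rewrite az mul0r add0r -/t -/c.
    have -> : 2 * (- (c + 1) / (2 * t)) * t = - (c + 1) by field.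
    by lra.
  apply/matrixP => i j; rewrite ord1 [RHS]mxE; apply/eqP.
  have : t == 0 by rewrite t0.
  rewrite /t mxE psumr_eq0; last by move=> l _; rewrite mxE -expr2 sqr_ge0.
  by move/allP/(_ i (mem_index_enum i)); rewrite /= [b^T _ _]mxE mulf_eq0 orbb.
have sab : Num.sqrt a *: ((Num.sqrt a)^-1 *: b) = b.
  have [az|an0] := eqVneq a 0; first by rewrite (b0 az) !scaler0.
  by rewrite scalerA mulfV ?scale1r // sqrtr_eq0 -ltNge lt_neqAle eq_sym an0.
have ssa : (Num.sqrt a)^-1 * (Num.sqrt a)^-1 = a^-1.
  by rewrite -invfM -expr2 sqr_sqrtr.
exists (block_mx (Num.sqrt a)%:M 0 ((Num.sqrt a)^-1 *: b) B).
rewrite Mblock tr_block_mx mulmx_block tr_scalar_mx !trmx0 !mul0mx !mulmx0 !addr0.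
rewrite -scalar_mxM -expr2 sqr_sqrtr // mul_mx_scalar mul_scalar_mx.
congr block_mx.
- by rewrite -linearZ sab.
- by rewrite sab.
- rewrite linearZ /= -scalemxAl -scalemxAr scalerA ssa -CB.
  by rewrite addrC subrK.
Qed.

(** * Grothendieck's inequality with a finite constant *)

Lemma sign_max_ge {R : realType} {m n : nat} (A : 'M[R]_(m, n)) e f :
  (forall i, e i = 1 \/ e i = -1) -> (forall j, f j = 1 \/ f j = -1) ->
  \sum_(i < m) \sum_(j < n) A i j * e i * f j <= sign_max A.
Proof.
move=> he hf; apply: ub_le_sup; last by exists e, f.
exists (\sum_(i < m) \sum_(j < n) `|A i j|) => s [e' [f' [he' [hf' ->]]]].
apply: ler_sum => i _; apply: ler_sum => j _; apply: le_trans (ler_norm _) _.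
have n1 (z : R) : z = 1 \/ z = -1 -> `|z| = 1 by case=> ->; rewrite ?normrN normr1.
by rewrite !normrM (n1 _ (he' i)) (n1 _ (hf' j)) !mulr1.
Qed.

Lemma sign_max_le {R : realType} {m n : nat} (A : 'M[R]_(m, n)) b :
  (forall e f, (forall i, e i = 1 \/ e i = -1) -> (forall j, f j = 1 \/ f j = -1) ->
    \sum_(i < m) \sum_(j < n) A i j * e i * f j <= b) -> sign_max A <= b.
Proof.
move=> h; apply: ge_sup.
  exists (\sum_(i < m) \sum_(j < n) A i j * 1 * 1), (fun=> 1), (fun=> 1).
  by split; [left|split; [left|]].
by move=> s [e [f [he [hf ->]]]]; exact: h.
Qed.

Lemma exists_sign {R : realType} (u : R) :
  exists e, (e = 1 \/ e = -1) /\ e * u = `|u|.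
Proof.
have [u0|u0] := leP 0 u.
  by exists 1; split; [left|rewrite mul1r ger0_norm].
by exists (-1); split; [right|rewrite mulN1r ltr0_norm].
Qed.

(** A bilinear form on a cube is largest at vertices: with [a] fixed, [b] is replaced by [c] times
    the signs of the column sums, and then [a] likewise by rows. *)
Lemma bilinear_le_sign_max {R : realType} {m n : nat} (A : 'M[R]_(m, n)) c a b :
  0 <= c -> (forall i, `|a i| <= c) -> (forall j, `|b j| <= c) ->
  \sum_(i < m) \sum_(j < n) A i j * a i * b j <= c ^+ 2 * sign_max A.
Proof.
move=> c0 ac bc.
have mul_le (z u e : R) : `|z| <= c -> e * u = `|u| -> z * u <= c * (e * u).
  move=> zc ->; apply: le_trans (ler_norm _) _.
  by rewrite normrM ler_wpM2r.
have /choice[f hf] j := exists_sign (\sum_i A i j * a i).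
have /choice[e he] i := exists_sign (\sum_j A i j * f j).
apply: (@le_trans _ _ (c * \sum_(i < m) \sum_(j < n) A i j * a i * f j)).
  rewrite exchange_big /= [X in _ <= c * X]exchange_big /= mulr_sumr.
  apply: ler_sum => j _; rewrite -!mulr_suml mulrC [X in c * X]mulrC.
  by apply: mul_le => //; exact: (hf j).2.
rewrite expr2 -mulrA ler_wpM2l//.
apply: (@le_trans _ _ (c * \sum_(i < m) \sum_(j < n) A i j * e i * f j)).
  rewrite mulr_sumr; apply: ler_sum => i _.
  under eq_bigr do rewrite mulrAC.
  under [X in _ <= c * X]eq_bigr do rewrite mulrAC.
  rewrite -!mulr_suml mulrC [X in c * X]mulrC.
  by apply: mul_le => //; exact: (he i).2.
by rewrite ler_wpM2l// sign_max_ge// => [i|j]; [exact: (he i).1|exact: (hf j).1].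
Qed.

Lemma sign_max_ge0 {R : realType} {m n : nat} (A : 'M[R]_(m, n)) : 0 <= sign_max A.
Proof.
have := @bilinear_le_sign_max R m n A 1 (fun=> 0) (fun=> 0).
rewrite expr1n mul1r big1 => [|i _]; last by rewrite big1 // => j _; rewrite mulr0.
by apply=> //; move=> *; rewrite normr0.
Qed.

(** Independent fair signs on a finite space, one more coin per step. Sums replace expectations,
    whence the factors [#|T|]. The identity turns inner products into correlations; the fourth
    moment bound controls tails. *)
Lemma rademacher_space (R : realType) (d : nat) :
  exists (T : finType) (e : 'I_d -> T -> R), [/\ (0 < #|T|)%N,
   forall x y, \sum_w (\sum_k x k * e k w) * (\sum_k y k * e k w)
     = #|T|%:R * \sum_k x k * y k
   & forall x, \sum_w (\sum_k x k * e k w) ^+ 4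
     <= 3 * #|T|%:R * (\sum_k x k ^+ 2) ^+ 2].
Proof.
elim: d => [|d [T [e [T0 e2 e4]]]].
  exists unit, (fun _ _ => 0); split=> [|x y|x].
  - by rewrite card_unit.
  - rewrite [LHS]big1 => [|w _]; last by rewrite big_ord0 mul0r.
    by rewrite big_ord0 mulr0.
  - rewrite [X in X <= _]big1 => [|w _]; last by rewrite big_ord0 expr0n.
    by rewrite mulr_ge0 ?sqr_ge0 ?mulr_ge0.
pose e' (k : 'I_d.+1) (w : T * bool) : R :=
  if unlift ord0 k is Some k' then e k' w.1 else (-1) ^+ w.2.
have e'E (x : 'I_d.+1 -> R) w b : \sum_k x k * e' k (w, b) =
    x ord0 * (-1) ^+ b + \sum_k x (lift ord0 k) * e k w.
  rewrite big_ord_recl /e' unlift_none /=; congr (_ + _).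
  by apply: eq_bigr => k _; rewrite liftK.
have T'E : #|{: T * bool}|%:R = #|T|%:R * 2 :> R.
  by rewrite card_prod card_bool natrM.
have cst (c : R) : \sum_(w : T) c = #|T|%:R * c by rewrite sumr_const mulr_natl.
exists (T * bool)%type, e'; split=> [|x y|x].
- by rewrite card_prod card_bool muln_gt0 T0.
- rewrite -(pair_bigA _ (fun w b => (\sum_k x k * e' k (w, b)) *
     (\sum_k y k * e' k (w, b)))) /=.
  rewrite T'E big_ord_recl.
  have := e2 (fun k => x (lift ord0 k)) (fun k => y (lift ord0 k)).
  under [in X in _ -> X]eq_bigr => w _.
    rewrite big_bool !e'E /= expr1 expr0.
    have -> : forall a b c d' : R, (a * -1 + c) * (b * -1 + d') + (a * 1 + c) * (b * 1 + d') =
      2 * (a * b) + 2 * (c * d') by move=> *; ring.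
    over.
  by rewrite big_split /= cst -!mulr_sumr => ->; ring.
- rewrite -(pair_bigA _ (fun w b => (\sum_k x k * e' k (w, b)) ^+ 4)) /=.
  rewrite T'E big_ord_recl.
  have := e4 (fun k => x (lift ord0 k)).
  have := e2 (fun k => x (lift ord0 k)) (fun k => x (lift ord0 k)).
  under [in X in _ -> _ -> X]eq_bigr => w _.
    rewrite big_bool !e'E /= expr1 expr0.
    have -> : forall a c : R, (a * -1 + c) ^+ 4 + (a * 1 + c) ^+ 4 =
      2 * a ^+ 4 + (12 * a ^+ 2 * (c * c) + 2 * c ^+ 4) by move=> *; ring.
    over.
  rewrite !big_split /= cst -!mulr_sumr => ->.
  set N := #|T|%:R; set s := \sum_k _ ^+ 2; set u := \sum_w _ => h4.
  set a := x ord0.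
  have N0 : 0 <= N by exact: ler0n.
  (* After [h4] the slack in the inequality is [4 * N * a ^+ 4]. *)
  have := mulr_ge0 N0 (sqr_ge0 (a ^+ 2)).
  nra.
Qed.

(** Unit balls in place of spheres, and any dimension, so that rescaled truncations and tails of
    random sums are again admissible vectors. *)
Definition gram_values {R : realType} {m n : nat} (A : 'M[R]_(m, n)) : set R :=
  [set s | exists (d : nat) (x : 'I_m -> 'I_d -> R) (y : 'I_n -> 'I_d -> R),
     [/\ forall i, \sum_k x i k ^+ 2 <= 1, forall j, \sum_k y j k ^+ 2 <= 1
       & s = \sum_i \sum_j A i j * \sum_k x i k * y j k]]%classic.

Lemma sum_mul_le_half {R : realType} {I : finType} (x y : I -> R) :
  `|\sum_k x k * y k| <= (\sum_k x k ^+ 2 + \sum_k y k ^+ 2) / 2.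
Proof.
rewrite -big_split /= mulr_suml; apply: le_trans (ler_norm_sum _ _ _) _.
apply: ler_sum => k _; rewrite ler_norml.
have := sqr_ge0 (x k + y k); have := sqr_ge0 (x k - y k).
by move=> h1 h2; apply/andP; split; nra.
Qed.

Lemma gram_values_has_sup {R : realType} {m n : nat} (A : 'M[R]_(m, n)) :
  has_sup (gram_values A).
Proof.
split.
  exists (\sum_i \sum_j A i j * \sum_(k < 0) 0 * 0), 0, (fun _ _ => 0), (fun _ _ => 0).
  by split=> // [i|j]; rewrite big_ord0 ler01.
exists (\sum_i \sum_j `|A i j|) => s [d [x [y [hx hy ->]]]].
apply: ler_sum => i _; apply: ler_sum => j _; apply: le_trans (ler_norm _) _.
rewrite normrM ler_piMr//; apply: le_trans (sum_mul_le_half _ _) _.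
by have := hx i; have := hy j; lra.
Qed.

Lemma sum_enum_val {V : nmodType} {I : finType} (F : I -> V) :
  \sum_i F i = \sum_(k < #|I|) F (enum_val k).
Proof. by rewrite -big_enum_val. Qed.

(** Functions on the sample space are treated as vectors of dimension [#|T|], which lets the
    rounding error be bounded by the very supremum under estimation. *)
Lemma gram_sup_scale {R : realType} {m n : nat} (A : 'M[R]_(m, n)) {T : finType}
    (f : 'I_m -> T -> R) (g : 'I_n -> T -> R) (a b : R) : 0 < a -> 0 < b ->
  (forall i, \sum_w f i w ^+ 2 <= a ^+ 2) -> (forall j, \sum_w g j w ^+ 2 <= b ^+ 2) ->
  \sum_i \sum_j A i j * (\sum_w f i w * g j w) <= a * b * sup (gram_values A).
Proof.
move=> a0 b0 hf hg.
pose x i (k : 'I_#|T|) := a^-1 * f i (enum_val k).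
pose y j (k : 'I_#|T|) := b^-1 * g j (enum_val k).
have ab0 : 0 < a * b by rewrite mulr_gt0.
rewrite -ler_pdivrMl//; apply: ub_le_sup; first exact: (gram_values_has_sup A).2.
exists #|T|, x, y; split.
- move=> i; under eq_bigr do rewrite exprMn.
  by rewrite -mulr_sumr -(sum_enum_val (fun w => f i w ^+ 2)) exprVn ler_pdivrMl ?mulr1 ?exprn_gt0.
- move=> j; under eq_bigr do rewrite exprMn.
  by rewrite -mulr_sumr -(sum_enum_val (fun w => g j w ^+ 2)) exprVn ler_pdivrMl ?mulr1 ?exprn_gt0.
- rewrite mulr_sumr; apply: eq_bigr => i _; rewrite mulr_sumr.
  apply: eq_bigr => j _; rewrite mulrCA; congr (_ * _).
  rewrite sum_enum_val mulr_sumr; apply: eq_bigr => k _.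
  by rewrite /x /y invfM; ring.
Qed.

(* Both families are expanded as Rademacher sums and truncated at height 8: the
   truncated parts are bounded pointwise by signs, and by the fourth moment bound
   the remainders have squared norm at most 3/64, so their contribution is
   absorbed by the supremum itself. *)
Lemma gram_sup_le_sign_max {R : realType} {m n : nat} (A : 'M[R]_(m, n)) :
  sup (gram_values A) <= 128 * sign_max A.
Proof.
set M := sup _; set s := sign_max A.
(* The term [64 = 8 ^+ 2] comes from the truncated parts; each of the two remainder terms costs
   [M / 4]. *)
suff : M <= 64 * s + M / 2 by lra.
apply: ge_sup => [|_ [d [x [y [hx hy ->]]]]]; first exact: (gram_values_has_sup A).1.
have [T [e [T0 e2 e4]]] := rademacher_space R d.
set N : R := #|T|%:R in e2 e4.
have N0 : 0 < N by rewrite ltr0n.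
pose X (z : 'I_d -> R) w := \sum_k z k * e k w.
pose cut (z : 'I_d -> R) w := if `|X z w| <= 8 then X z w else 0.
pose tail (z : 'I_d -> R) w := X z w - cut z w.
have X2 (z : 'I_d -> R) : \sum_k z k ^+ 2 <= 1 -> \sum_w X z w ^+ 2 <= Num.sqrt N ^+ 2.
  move=> hz; rewrite sqr_sqrtr ?(ltW N0)//.
  have -> : \sum_w X z w ^+ 2 = N * \sum_k z k ^+ 2.
    by under eq_bigr do rewrite expr2; rewrite e2.
  by rewrite ger_pMr.
have cut2 (z : 'I_d -> R) : \sum_k z k ^+ 2 <= 1 -> \sum_w cut z w ^+ 2 <= Num.sqrt N ^+ 2.
  move=> /X2; apply: le_trans; apply: ler_sum => w _; rewrite /cut.
  by case: ifP => // _; rewrite expr0n sqr_ge0.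
have tail2 (z : 'I_d -> R) : \sum_k z k ^+ 2 <= 1 ->
    \sum_w tail z w ^+ 2 <= (Num.sqrt N / 4) ^+ 2.
  move=> hz; rewrite exprMn sqr_sqrtr ?(ltW N0)//.
  have : \sum_w X z w ^+ 4 <= 3 * N.
    apply: le_trans (e4 z) _; rewrite ler_piMr ?mulr_ge0// ?(ltW N0)//.
    by rewrite expr_le1// sumr_ge0// => k _; rewrite sqr_ge0.
  (* The tail lives where [X z w ^+ 2 >= 64]. The resulting [3 * N / 64] is rounded up to [N / 16],
     a perfect square times [N]. *)
  have : \sum_w tail z w ^+ 2 <= \sum_w X z w ^+ 4 / 64.
    apply: ler_sum => w _; rewrite /tail /cut; case: ifPn => [_|].
      by rewrite subrr expr0n divr_ge0// exprn_even_ge0.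
    rewrite -ltNge subr0 => X8.
    have : 64 <= X z w ^+ 2.
      rewrite -real_normK ?num_real//; nra.
    have -> : X z w ^+ 4 = X z w ^+ 2 * X z w ^+ 2 by rewrite -exprD.
    by nra.
  by rewrite -mulr_suml; lra.
have sN : 0 < Num.sqrt N by rewrite sqrtr_gt0.
have sN4 : 0 < Num.sqrt N / 4 by rewrite divr_gt0.
have cut8 z w : `|cut z w| <= 8 by rewrite /cut; case: ifP; rewrite ?normr0.
have h1 : \sum_i \sum_j A i j * (\sum_w cut (x i) w * cut (y j) w) <= N * (64 * s).
  under eq_bigr do under eq_bigr do rewrite mulr_sumr.
  under eq_bigr do rewrite exchange_big /=.
  rewrite exchange_big /=.
  apply: (@le_trans _ _ (\sum_(w : T) 64 * s)); last first.
    by rewrite sumr_const /N [X in _ <= X]mulr_natl.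
  apply: ler_sum => w _.
  under eq_bigr do under eq_bigr do rewrite mulrA.
  have -> : 64 = 8 ^+ 2 :> R by ring.
  exact: (bilinear_le_sign_max A 8 (fun i => cut (x i) w) (fun j => cut (y j) w)).
have h2 := gram_sup_scale A _ _ _ _ sN4 sN (fun i => tail2 _ (hx i)) (fun j => cut2 _ (hy j)).
have h3 := gram_sup_scale A _ _ _ _ sN sN4 (fun i => X2 _ (hx i)) (fun j => tail2 _ (hy j)).
rewrite -(ler_pM2l N0).
have <- : Num.sqrt N * Num.sqrt N = N by rewrite -expr2 sqr_sqrtr ?(ltW N0).
(* Telescoping of the product: [X X' = cut cut' + tail cut' + X tail']. *)
have -> : Num.sqrt N * Num.sqrt N * \sum_i \sum_j A i j * (\sum_k x i k * y j k) =
   \sum_i \sum_j A i j * (\sum_w cut (x i) w * cut (y j) w) +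
   \sum_i \sum_j A i j * (\sum_w tail (x i) w * cut (y j) w) +
   \sum_i \sum_j A i j * (\sum_w X (x i) w * tail (y j) w).
  rewrite -expr2 sqr_sqrtr ?(ltW N0)// mulr_sumr -!big_split /=; apply: eq_bigr => i _.
  rewrite mulr_sumr -!big_split /=; apply: eq_bigr => j _.
  rewrite mulrCA -e2 -!mulrDr -!big_split /=; congr (_ * _).
  by apply: eq_bigr => w _; rewrite /tail -/(X (x i) w) -/(X (y j) w); ring.
apply: le_trans (lerD (lerD h1 h2) h3) _.
have {1}-> : N = Num.sqrt N * Num.sqrt N by rewrite -expr2 sqr_sqrtr ?(ltW N0).
by rewrite -/M; lra.
Qed.

Lemma row_mul_trE {R : realType} {d : nat} (x y : 'rV[R]_d) :
  (x *m y^T) 0 0 = \sum_k x 0 k * y 0 k.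
Proof. by rewrite mxE; apply: eq_bigr => k _; rewrite mxE. Qed.

Definition grothendieck_bounds (R : realType) : set R :=
  [set K | forall (m n d : nat) (A : 'M[R]_(m, n))
     (x : 'I_m -> 'rV[R]_d) (y : 'I_n -> 'rV[R]_d),
     (forall i, (x i *m (x i)^T) 0 0 = 1) ->
     (forall j, (y j *m (y j)^T) 0 0 = 1) ->
     \sum_(i < m) \sum_(j < n) A i j * (x i *m (y j)^T) 0 0
       <= K * sign_max A]%classic.

Lemma grothendieck_bounds128 (R : realType) : grothendieck_bounds R 128.
Proof.
move=> m n d A x y hx hy; apply: le_trans (gram_sup_le_sign_max A).
apply: ub_le_sup; first exact: (gram_values_has_sup A).2.
exists d, (fun i k => x i 0 k), (fun j k => y j 0 k); split.
- by move=> i; rewrite -[X in _ <= X](hx i) row_mul_trE; apply: ler_sum.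
- by move=> j; rewrite -[X in _ <= X](hy j) row_mul_trE; apply: ler_sum.
- by apply: eq_bigr => i _; apply: eq_bigr => j _; rewrite row_mul_trE.
Qed.

(** The 1 by 1 matrix with entry 1 is the test case. *)
Lemma grothendieck_bounds_ge1 (R : realType) K : grothendieck_bounds R K -> 1 <= K.
Proof.
move=> hK; pose u : 'rV[R]_1 := const_mx 1.
have uu : (u *m u^T) 0 0 = 1 by rewrite row_mul_trE big_ord1 mxE mulr1.
have := hK 1 1 1%N (const_mx 1) (fun=> u) (fun=> u) (fun=> uu) (fun=> uu).
rewrite !big_ord1 uu mxE mulr1 => h.
have s0 := sign_max_ge0 (const_mx 1 : 'M[R]_1).
have s1 : sign_max (const_mx 1 : 'M[R]_1) <= 1.
  apply: sign_max_le => e f he hf; rewrite !big_ord1 mxE mul1r.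
  by case: (he 0) => ->; case: (hf 0) => ->; lra.
have K0 : 0 < K.
  rewrite ltNge; apply/negP => Kn.
  by have := ler_wpM2r s0 Kn; rewrite mul0r; lra.
by apply: le_trans h _; rewrite ger_pMr.
Qed.

Lemma grothendieck_const_ge1 (R : realType) : 1 <= grothendieck_const R.
Proof.
apply: lb_le_inf; first by exists 128; exact: grothendieck_bounds128.
by move=> K; exact: grothendieck_bounds_ge1.
Qed.

(** For fixed data the bound reads [L / sign_max A <= K] and so passes to the infimum. If
    [sign_max A = 0], the constant 128 already gives [L <= 0]. *)
Lemma grothendieck_const_bound (R : realType) :
  grothendieck_bounds R (grothendieck_const R).
Proof.
move=> m n d A x y hx hy; set L := \sum_i _.
have := sign_max_ge0 A; rewrite le_eqVlt => /predU1P[s0|s0].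
  by have := @grothendieck_bounds128 R m n d A x y hx hy; rewrite -s0 !mulr0.
rewrite -ler_pdivrMr//; apply: lb_le_inf; first by exists 128; exact: grothendieck_bounds128.
by move=> K hK; rewrite ler_pdivrMr//; exact: hK.
Qed.

(** * Power norms: Minkowski's inequality and dual vectors *)

Definition lnorm {R : realType} (r : R) {k : nat} (f : 'I_k -> R) : R :=
  (\sum_i `|f i| `^ r) `^ r^-1.

Lemma powR_le_cancel {R : realType} (r a b : R) :
  0 < r -> 0 <= a -> 0 <= b -> a `^ r <= b `^ r -> a <= b.
Proof.
move=> r0 a0 b0; apply: contraTT; rewrite -!ltNge => ab.
by rewrite gt0_ltr_powR.
Qed.

Lemma powRV_cancel {R : realType} (r a : R) : r != 0 -> 0 <= a -> (a `^ r^-1) `^ r = a.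
Proof. by move=> r0 a0; rewrite -powRrM mulVf// powRr1. Qed.

Lemma powR_div {R : realType} (r a b : R) :
  0 <= a -> 0 <= b -> (a / b) `^ r = a `^ r / b `^ r.
Proof.
move=> a0 b0; rewrite powRM ?invr_ge0//; congr (_ * _).
by rewrite -(powR_inv1 b0) powRAC powR_inv1 ?powR_ge0.
Qed.

Lemma sum_powR_ge0 {R : realType} (r : R) {k : nat} (f : 'I_k -> R) :
  0 <= \sum_i `|f i| `^ r.
Proof. by apply: sumr_ge0 => i _; exact: powR_ge0. Qed.

Lemma lnorm_ge0 {R : realType} (r : R) {k : nat} (f : 'I_k -> R) : 0 <= lnorm r f.
Proof. exact: powR_ge0. Qed.

Lemma powR_lnorm {R : realType} (r : R) {k : nat} (f : 'I_k -> R) :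
  0 < r -> lnorm r f `^ r = \sum_i `|f i| `^ r.
Proof. by move=> r0; rewrite powRV_cancel ?gt_eqF// sum_powR_ge0. Qed.

Lemma lnorm_le {R : realType} (r c : R) {k : nat} (f : 'I_k -> R) :
  0 < r -> 0 <= c -> (lnorm r f <= c) = (\sum_i `|f i| `^ r <= c `^ r).
Proof.
move=> r0 c0; rewrite -powR_lnorm//; apply/idP/idP => h.
  by apply: ge0_ler_powR => //; rewrite ?nnegrE ?lnorm_ge0// ltW.
exact: powR_le_cancel (lnorm_ge0 _ _) c0 h.
Qed.

Lemma lnorm_le1 {R : realType} (r : R) {k : nat} (f : 'I_k -> R) :
  0 < r -> (lnorm r f <= 1) = (\sum_i `|f i| `^ r <= 1).
Proof. by move=> r0; rewrite lnorm_le// powR1. Qed.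

Lemma lnorm0 {R : realType} (r : R) {k : nat} : 0 < r ->
  lnorm r (fun _ : 'I_k => 0) = 0.
Proof.
move=> r0; rewrite /lnorm big1 => [|i _]; first by rewrite powR0// invr_eq0 gt_eqF.
by rewrite normr0 powR0 ?gt_eqF.
Qed.

Lemma lnormZ {R : realType} (r t : R) {k : nat} (f : 'I_k -> R) : 0 < r -> 0 <= t ->
  lnorm r (fun i => t * f i) = t * lnorm r f.
Proof.
move=> r0 t0; rewrite /lnorm.
under eq_bigr do rewrite normrM (ger0_norm t0) powRM//.
rewrite -mulr_sumr powRM ?powR_ge0 ?sum_powR_ge0// -powRrM mulfV ?gt_eqF//.
by rewrite powRr1.
Qed.

Lemma pnormE {R : realType} (p : R) {k : nat} (x : 'cV[R]_k) :
  pnorm p x = lnorm p (fun i => x i 0).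
Proof. by []. Qed.

(* Otherwise unification unfolds the real powers when it compares norms. *)
Opaque lnorm.

Lemma lnorm_eq0 {R : realType} (r : R) {k : nat} (f : 'I_k -> R) : 0 < r ->
  lnorm r f = 0 -> forall i, f i = 0.
Proof.
move=> r0 f0 i; have := powR_lnorm r f r0; rewrite f0 powR0 ?gt_eqF// => /esym/eqP.
rewrite psumr_eq0; last by move=> j _; exact: powR_ge0.
move=> /allP/(_ i (mem_index_enum i)); rewrite /= powR_eq0 => /andP[].
by rewrite normr_eq0 => /eqP.
Qed.

(** Young's inequality bounds [a * z]^ (r - 1)[and]b * z [^ (r - 1)], whose weighted mean is [z]^
    r[; the share of]z [^ r] on the right is then absorbed. *)
Lemma powR_convex {R : realType} (r s a b : R) : 1 < r -> 0 <= s <= 1 ->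
  0 <= a -> 0 <= b ->
  (s * a + (1 - s) * b) `^ r <= s * a `^ r + (1 - s) * b `^ r.
Proof.
move=> r1 /andP[s0 s1] a0 b0; set z := s * a + (1 - s) * b.
have z0 : 0 <= z by rewrite addr_ge0// mulr_ge0// subr_ge0.
have r0 : 0 < r by exact: lt_trans r1.
have r10 : 0 < r - 1 by rewrite subr_gt0.
have q0 : 0 < r / (r - 1) by rewrite divr_gt0.
have rn0 : (r != 0) && (r - 1 != 0) by rewrite !gt_eqF.
have young c : 0 <= c -> c * z `^ (r - 1) <= c `^ r / r + z `^ r / (r / (r - 1)).
  move=> c0; have := @conjugate_powR _ c (z `^ (r - 1)) r (r / (r - 1)) c0 (powR_ge0 _ _).
  have -> : (z `^ (r - 1)) `^ (r / (r - 1)) = z `^ r.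
    by rewrite -powRrM; congr (_ `^ _); field; rewrite gt_eqF.
  apply=> //.
  by field; rewrite !gt_eqF.
have zE : z `^ r = s * (a * z `^ (r - 1)) + (1 - s) * (b * z `^ (r - 1)).
  by rewrite -mulr_powRB1// {1}/z; ring.
have h1 := ler_wpM2l s0 (young a a0).
have s1' : 0 <= 1 - s by rewrite subr_ge0.
have h2 := ler_wpM2l s1' (young b b0).
have := lerD h1 h2; rewrite -zE.
set A := a `^ r; set B := b `^ r; set Z := z `^ r.
have -> : s * (A / r + Z / (r / (r - 1))) + (1 - s) * (B / r + Z / (r / (r - 1))) =
  (s * A + (1 - s) * B) / r + Z - Z / r by field; rewrite !gt_eqF.
rewrite -addrA (addrC Z) addrA lerDr subr_ge0 ler_pM2r// invr_gt0//.
Qed.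

Lemma lnormD {R : realType} (r : R) {k : nat} (f g : 'I_k -> R) : 1 < r ->
  lnorm r (fun i => f i + g i) <= lnorm r f + lnorm r g.
Proof.
move=> r1; have r0 : 0 < r by exact: lt_trans r1.
(* Strictly positive majorants avoid division by a zero norm; convexity is then used with weight
   [a / (a + b)]. *)
suff main a b : 0 < a -> 0 < b -> lnorm r f <= a -> lnorm r g <= b ->
    lnorm r (fun i => f i + g i) <= a + b.
  apply/ler_addgt0Pr => e e0.
  have e2 : 0 < e / 2 by rewrite divr_gt0.
  rewrite {1}[e]splitr addrACA.
  by apply: main; rewrite ?ltr_wpDl ?lnorm_ge0// lerDl ltW.
move=> a0 b0; have ab0 : 0 < a + b by rewrite addr_gt0.
move=> fa gb; rewrite lnorm_le//; last exact: ltW.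
have {}fa : \sum_i `|f i| `^ r <= a `^ r by rewrite -lnorm_le// ltW.
have {}gb : \sum_i `|g i| `^ r <= b `^ r by rewrite -lnorm_le// ltW.
pose s := a / (a + b).
have sE : 1 - s = b / (a + b) by rewrite /s; field; rewrite gt_eqF.
have s01 : 0 <= s <= 1.
  by rewrite divr_ge0 ?(ltW a0) ?(ltW ab0)//= ler_pdivrMr// mul1r lerDl ltW.
have /andP[s0 s1] := s01.
apply: (@le_trans _ _ (\sum_i (a + b) `^ r *
   (s * (`|f i| `^ r / a `^ r) + (1 - s) * (`|g i| `^ r / b `^ r)))).
  apply: ler_sum => i _.
  have fa0 : 0 <= `|f i| / a by rewrite divr_ge0 ?(ltW a0) ?(ltW b0).
  have gb0 : 0 <= `|g i| / b by rewrite divr_ge0 ?(ltW a0) ?(ltW b0).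
  rewrite -!powR_div ?(ltW a0) ?(ltW b0)//.
  apply: (@le_trans _ _ (((a + b) * (s * (`|f i| / a) + (1 - s) * (`|g i| / b))) `^ r)).
    have -> : (a + b) * (s * (`|f i| / a) + (1 - s) * (`|g i| / b)) = `|f i| + `|g i|.
      by rewrite sE /s; field; rewrite !gt_eqF.
    apply: ge0_ler_powR; rewrite ?nnegrE ?addr_ge0 ?ler_normD//.
    exact: ltW.
  have c0 : 0 <= s * (`|f i| / a) + (1 - s) * (`|g i| / b).
    by rewrite addr_ge0// mulr_ge0// subr_ge0.
  rewrite (powRM _ (ltW ab0) c0).
  by rewrite ler_wpM2l ?powR_ge0// powR_convex.
rewrite -mulr_sumr ler_piMr ?powR_ge0// big_split /= -!mulr_sumr -!mulr_suml.
have h1 : (\sum_i `|f i| `^ r) / a `^ r <= 1.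
  by rewrite ler_pdivrMr ?mul1r// powR_gt0.
have h2 : (\sum_i `|g i| `^ r) / b `^ r <= 1.
  by rewrite ler_pdivrMr ?mul1r// powR_gt0.
have h3 := ler_wpM2l s0 h1.
have s1' : 0 <= 1 - s by rewrite subr_ge0.
have h4 := ler_wpM2l s1' h2.
lra.
Qed.

Lemma lnorm_dual {R : realType} (r : R) {k : nat} (v : 'I_k -> R) : 1 < r ->
  (forall i, 0 <= v i) ->
  exists d, lnorm r d <= 1 /\ \sum_i v i * d i = lnorm (r / (r - 1)) v.
Proof.
move=> r1 v0; have r0 : 0 < r by exact: lt_trans r1.
have r10 : 0 < r - 1 by rewrite subr_gt0.
set q := r / (r - 1); have q0 : 0 < q by rewrite divr_gt0.
have [vz|vz] := eqVneq (lnorm q v) 0.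
  exists (fun=> 0); rewrite lnorm0// ler01 vz; split=> //.
  by rewrite big1// => i _; rewrite mulr0.
have nu0 : 0 < lnorm q v by rewrite lt_neqAle eq_sym vz lnorm_ge0.
set nu := lnorm q v in nu0 *.
have nuE : \sum_i v i `^ q = nu `^ q.
  by rewrite powR_lnorm//; apply: eq_bigr => i _; rewrite ger0_norm.
clearbody nu.
have q1r : (q - 1) * r = q by rewrite /q; field; rewrite gt_eqF.
have nuV : 0 <= (nu `^ (q - 1))^-1 by rewrite invr_ge0 powR_ge0.
(* The equality case of Hölder's inequality; [(q - 1) * r = q] makes its norm 1. *)
exists (fun i => v i `^ (q - 1) / nu `^ (q - 1)); split.
  rewrite lnorm_le1//.
  under eq_bigr => i _.
    rewrite ger0_norm ?divr_ge0 ?powR_ge0// powR_div ?powR_ge0// -!powRrM q1r.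
    over.
  by rewrite -mulr_suml nuE divff// gt_eqF// powR_gt0.
under eq_bigr do rewrite mulrA mulr_powRB1//.
by rewrite -mulr_suml nuE -(mulr_powRB1 (ltW nu0) q0) mulfK// gt_eqF// powR_gt0.
Qed.

(** * The cone [Kp3] and the constant [theta] *)

(** In this form [1 - 2 / p] is [1 / q] for [q = p / (p - 2)], the weight of the second term in
    Young's inequality. *)
Lemma theta_factor {R : realType} (p : R) : 2 < p ->
  theta p = (2 / p) `^ (2 / (p - 2)) * (1 - 2 / p).
Proof.
move=> p2; have p0 : 0 < p by lra.
have p20 : p - 2 != 0 by rewrite subr_eq0 gt_eqF.
rewrite /theta; have -> : p / (p - 2) = 2 / (p - 2) + 1 by field.
have c0 : 2 / p != 0 by rewrite gt_eqF// divr_gt0.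
rewrite powRD ?c0 ?implybT//.
by rewrite powRr1 ?divr_ge0// ?ltW// mulrBr mulr1.
Qed.

Lemma theta_ge0 {R : realType} (p : R) : 2 < p -> 0 <= theta p.
Proof.
move=> p2; rewrite theta_factor// mulr_ge0 ?powR_ge0// subr_ge0 ler_pdivrMr ?mul1r; lra.
Qed.

Lemma Kp3_young {R : realType} (p v u t x : R) : 2 < p -> Kp3 p v u t -> 0 <= x ->
  v * x <= u * x `^ (p / 2) + theta p * t.
Proof.
move=> p2 [u0 [v0 [t0 hK]]] x0; have p0 : 0 < p by lra.
have p20 : 0 < p - 2 by lra.
have q0 : 0 < p / (p - 2) by rewrite divr_gt0.
have k0 : 0 < 2 / (p - 2) by rewrite divr_gt0.
have r0 : 0 < p / 2 by rewrite divr_gt0.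
have tt := mulr_ge0 (theta_ge0 _ p2) t0.
move: u0; rewrite le_eqVlt => /predU1P[u0|u0].
  move: hK; rewrite -u0 powR0 ?gt_eqF// mulr0 => hv.
  have /eqP : v `^ (p / (p - 2)) = 0 by apply: le_anti; rewrite hv powR_ge0.
  by rewrite powR_eq0 => /andP[/eqP -> _]; rewrite !mul0r add0r.
pose w := (p / 2 * u) `^ (p / 2)^-1.
have w0 : 0 < w by rewrite powR_gt0// mulr_gt0.
have -> : v * x = (x * w) * (v / w) by field; rewrite gt_eqF.
have := @conjugate_powR _ (x * w) (v / w) (p / 2) (p / (p - 2)).
rewrite mulr_ge0 ?(ltW w0)// divr_ge0 ?(ltW w0)//.
have -> : (p / 2)^-1 + (p / (p - 2))^-1 = 1.
  by field; rewrite !gt_eqF.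
move=> /(_ isT isT r0 q0 erefl) /le_trans; apply.
have pu0 : 0 <= p / 2 * u by rewrite mulr_ge0 ?ltW.
rewrite powRM ?(ltW w0)// powRV_cancel ?gt_eqF// powR_div ?(ltW w0)//.
have -> : w `^ (p / (p - 2)) = (2 / p) `^ (- (2 / (p - 2))) * u `^ (2 / (p - 2)).
  rewrite -powRrM; have -> : (p / 2)^-1 * (p / (p - 2)) = 2 / (p - 2).
    by field; rewrite !gt_eqF.
  rewrite powRM ?(ltW u0) ?(ltW r0)//; congr (_ * _).
  have -> : p / 2 = (2 / p)^-1 by rewrite invf_div.
  by rewrite -powR_inv1 ?divr_ge0 ?(ltW p0)// -powRrM mulN1r.
have -> : x `^ (p / 2) * (p / 2 * u) / (p / 2) = u * x `^ (p / 2).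
  by field; rewrite gt_eqF.
rewrite lerD2l theta_factor// powRN.
set c := (2 / p) `^ _; set k := u `^ _ in hK *; set V := v `^ _ in hK *.
have c0 : 0 < c by rewrite powR_gt0// divr_gt0.
have uk0 : 0 < k by rewrite powR_gt0.
have -> : V / (c^-1 * k) / (p / (p - 2)) = c * (1 - 2 / p) * (V / k).
  by field; rewrite !gt_eqF.
rewrite ler_wpM2l//; last by rewrite ler_pdivrMr.
by rewrite mulr_ge0 ?(ltW c0)// subr_ge0 ler_pdivrMr ?mul1r//; exact: ltW.
Qed.

(* [u = (2/p) ||v||_q] minimises [u + theta_p * sum_i t_i] when the constraints
   [v_i^q <= t_i u^(q-1)] are tight, and the minimum is [||v||_q]. *)
Lemma Kp3_lnorm {R : realType} (p : R) {k : nat} (v : 'I_k -> R) : 2 < p ->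
  (forall i, 0 <= v i) ->
  exists u t, (forall i, Kp3 p (v i) u (t i)) /\
    u + theta p * \sum_i t i <= lnorm (p / (p - 2)) v.
Proof.
move=> p2 v0; have p0 : 0 < p by lra.
have p20 : 0 < p - 2 by lra.
have q0 : 0 < p / (p - 2) by rewrite divr_gt0.
have k0 : 0 < 2 / (p - 2) by rewrite divr_gt0.
set q := p / (p - 2) in q0 *; set h := 2 / (p - 2) in k0 *.
have [nz|nz] := eqVneq (lnorm q v) 0.
  exists 0, (fun=> 0); split=> [i|].
    rewrite (lnorm_eq0 _ _ q0 nz i); split=> //; split=> //; split=> //.
    by rewrite mul0r powR0 ?gt_eqF.
  by rewrite nz big1 // mulr0 addr0.
have : 0 < lnorm q v by rewrite lt_neqAle eq_sym nz lnorm_ge0.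
have : \sum_i v i `^ q = lnorm q v `^ q.
  by rewrite powR_lnorm//; apply: eq_bigr => i _; rewrite ger0_norm.
move: (lnorm q v) => nu nuE nu0.
have u0 : 0 < 2 / p * nu by rewrite mulr_gt0// divr_gt0.
exists (2 / p * nu), (fun i => v i `^ q / (2 / p * nu) `^ h); split=> [i|].
  split; first exact: ltW.
  split=> //; split; first by rewrite divr_ge0 ?powR_ge0.
  by rewrite -/q -/h divfK// gt_eqF// powR_gt0.
have c0 : 0 < (2 / p) `^ h by rewrite powR_gt0// divr_gt0.
have p20' : 0 <= 2 / p by rewrite divr_ge0 ?(ltW p0).
rewrite -mulr_suml nuE theta_factor// -/h (powRM _ p20' (ltW nu0)).
have -> : nu `^ q = nu `^ h * nu.
  have -> : q = h + 1 by rewrite /q /h; field; rewrite gt_eqF.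
  by rewrite powRD ?(gt_eqF nu0) ?implybT// powRr1 ?(ltW nu0).
have kn0 : 0 < nu `^ h by rewrite powR_gt0.
move: (nu `^ h) kn0 ((2 / p) `^ h) c0 => a a0 b b0.
by rewrite le_eqVlt; apply/orP; left; apply/eqP; field; rewrite !gt_eqF.
Qed.

(** * The psd pairing, the v-norm and feasibility for (P) *)

Lemma frob_outer {R : realType} {m n : nat} (A : 'M[R]_(m, n))
    (x : 'cV[R]_m) (y : 'cV[R]_n) :
  frob A (x *m y^T) = (x^T *m A *m y) 0 0.
Proof.
rewrite mxE [RHS](eq_bigr (fun j => \sum_i A i j * (x i 0 * y j 0))).
  rewrite exchange_big; apply: eq_bigr => i _; apply: eq_bigr => j _.
  by rewrite mxE big_ord1 mxE.
move=> j _; rewrite mxE mulr_suml; apply: eq_bigr => i _; rewrite mxE; ring.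
Qed.

Lemma gram_sum_cols {R : realType} {k l : nat} (B : 'M[R]_(k, l)) :
  B *m B^T = \sum_i col i B *m (col i B)^T.
Proof.
apply/matrixP => i j; rewrite mxE summxE; apply: eq_bigr => h _.
by rewrite !mxE big_ord1 !mxE.
Qed.

(** A Gram matrix is a sum of outer squares of columns, and pairing [D] with each of them evaluates
    its quadratic form. *)
Lemma frob_psd_ge0 {R : realType} {k : nat} (D X : 'M[R]_k) :
  psd D -> psd X -> 0 <= frob D X.
Proof.
move=> [_ D0] /psd_gram[B ->]; rewrite gram_sum_cols frob_sumr.
by apply: sumr_ge0 => i _; rewrite frob_outer.
Qed.

Lemma frob_diag {R : realType} {k : nat} (v : 'rV[R]_k) X :
  frob (diag_mx v) X = \sum_i v 0 i * X i i.
Proof.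
apply: eq_bigr => i _; rewrite (bigD1 i)//= big1 => [|j ji].
  by rewrite mxE eqxx mulr1n addr0.
by rewrite mxE eq_sym (negPf ji) mulr0n mul0r.
Qed.

Lemma frob_sym_block {R : realType} {m n : nat} (Z : 'M[R]_(m, n)) X : X^T = X ->
  frob (sym_block Z) X = \sum_i \sum_j Z i j * X (lshift n i) (rshift m j).
Proof.
move=> Xs; have XC i j : X i j = X j i by rewrite -[in LHS]Xs mxE.
rewrite /frob big_split_ord /=.
have -> : \sum_i \sum_j sym_block Z (lshift n i) j * X (lshift n i) j =
    \sum_i \sum_j 2^-1 * (Z i j * X (lshift n i) (rshift m j)).
  apply: eq_bigr => i _; rewrite big_split_ord /= big1 ?add0r => [|j _].
    by apply: eq_bigr => j _; rewrite block_mxEur mxE mulrA.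
  by rewrite block_mxEul mxE mul0r.
have -> : \sum_i \sum_j sym_block Z (rshift m i) j * X (rshift m i) j =
    \sum_i \sum_j 2^-1 * (Z j i * X (lshift n j) (rshift m i)).
  apply: eq_bigr => i _; rewrite big_split_ord /= addrC big1 ?add0r => [|j _].
    by apply: eq_bigr => j _; rewrite block_mxEdl !mxE mulrA (XC (rshift m i)).
  by rewrite block_mxEdr mxE mul0r.
rewrite [X in _ + X]exchange_big -big_split /=; apply: eq_bigr => i _.
by rewrite -big_split /=; apply: eq_bigr => j _; field.
Qed.

Lemma sym_block_tr {R : realType} {m n : nat} (Z : 'M[R]_(m, n)) :
  (sym_block Z)^T = sym_block Z.
Proof. by rewrite /sym_block tr_block_mx !trmx0 !linearZ /= trmxK. Qed.

Lemma psd_outer {R : realType} {k : nat} (x : 'cV[R]_k) : psd (x *m x^T).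
Proof.
split=> [|y]; first by rewrite trmx_mul trmxK.
rewrite mulmxA -mulmxA mxE big_ord1 (mul_trmxC y x) -expr2; exact: sqr_ge0.
Qed.

Lemma psd0 {R : realType} {k : nat} : psd (0 : 'M[R]_k).
Proof. by split=> [|x]; rewrite ?trmx0// mulmx0 mul0mx mxE. Qed.

Lemma psdD {R : realType} {k : nat} (X Y : 'M[R]_k) : psd X -> psd Y -> psd (X + Y).
Proof.
move=> [Xs X0] [Ys Y0]; split=> [|x]; first by rewrite linearD /= Xs Ys.
by rewrite mulmxDr mulmxDl addmxE addr_ge0.
Qed.

Lemma psdZ {R : realType} {k : nat} t (X : 'M[R]_k) : 0 <= t -> psd X -> psd (t *: X).
Proof.
move=> t0 [Xs X0]; split=> [|x]; first by rewrite linearZ /= Xs.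
by rewrite -scalemxAr -scalemxAl scalemxE mulr_ge0.
Qed.

Lemma psd_diag_ge0 {R : realType} {k : nat} (X : 'M[R]_k) i : psd X -> 0 <= X i i.
Proof.
move=> /psd_gram[B ->]; rewrite mxE; apply: sumr_ge0 => j _.
by rewrite mxE -expr2 sqr_ge0.
Qed.

Definition v_feasible {R : realType} (p : R) {m n : nat} (X : 'M[R]_(m + n)) : Prop :=
  \sum_(i < m) `|X (lshift n i) (lshift n i)| `^ (p / 2) <= 1 /\
  \sum_(j < n) `|X (rshift m j) (rshift m j)| `^ (p / 2) <= 1 /\ psd X.

Lemma v_feasible_diag_le1 {R : realType} (p : R) {m n : nat} (X : 'M[R]_(m + n)) i :
  0 < p -> v_feasible p X -> X i i <= 1.
Proof.
move=> p0 [X1 [X2 _]]; apply: le_trans (ler_norm _) _.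
have r0 : 0 < p / 2 by rewrite divr_gt0.
have one k (f : 'I_k -> R) j : \sum_j `|f j| `^ (p / 2) <= 1 -> `|f j| <= 1.
  move=> h; apply: powR_le_cancel r0 _ _ _ => //; rewrite powR1.
  apply: le_trans h; rewrite (bigD1 j)//= lerDl.
  by apply: sumr_ge0 => l _; exact: powR_ge0.
case: (split_ordP i) => j ->.
  exact: (one m (fun i => X (lshift n i) (lshift n i))).
exact: (one n (fun i => X (rshift m i) (rshift m i))).
Qed.

(** The content is that the supremum is finite: diagonal entries are at most 1, so the Gram
    factorization bounds every entry of a feasible matrix by 1. *)
Lemma frob_le_v_pnorm {R : realType} (p : R) {m n : nat} (Z : 'M[R]_(m, n)) X :
  0 < p -> v_feasible p X -> frob (sym_block Z) X <= v_pnorm p Z.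
Proof.
move=> p0 hX; apply: ub_le_sup; last by have [h1 [h2 h3]] := hX; exists X.
exists (\sum_i \sum_j `|sym_block Z i j|) => s [Y [h1 [h2 [Ypsd ->]]]].
have Yle i : Y i i <= 1 by apply: v_feasible_diag_le1 p0 _.
apply: ler_sum => i _; apply: ler_sum => j _; apply: le_trans (ler_norm _) _.
rewrite normrM ler_piMr//; have [B YB] := psd_gram _ Ypsd.
have Yii l : \sum_k B l k ^+ 2 <= 1.
  by have := Yle l; rewrite YB mxE; under eq_bigr do rewrite mxE -expr2.
rewrite YB mxE; under eq_bigr do rewrite mxE.
apply: le_trans (sum_mul_le_half _ _) _.
by have := Yii i; have := Yii j; lra.
Qed.

Lemma v_pnorm_le {R : realType} (p : R) {m n : nat} (Z : 'M[R]_(m, n)) b : 0 < p ->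
  (forall X, v_feasible p X -> frob (sym_block Z) X <= b) -> v_pnorm p Z <= b.
Proof.
move=> p0 h; apply: ge_sup => [|_ [X [h1 [h2 [h3 ->]]]]]; last exact: h.
exists (frob (sym_block Z) 0), 0.
have z k (f : 'I_k -> 'I_(m + n)) :
    \sum_i `|(0 : 'M[R]_(m + n)) (f i) (f i)| `^ (p / 2) <= 1.
  rewrite big1 // => i _.
  by rewrite mxE normr0 powR0// mulf_neq0 ?gt_eqF// invr_gt0.
by split; [exact: z|split; [exact: z|split; [exact: psd0|]]].
Qed.

(** Weak duality: [diag_mx v] dominates [sym_block Z] against psd matrices, and [Kp3_young] bounds
    its pairing with a feasible [X] by the budget [u1 + u2 + theta p * \sum_i t 0 i]. *)
Lemma P_feasible_v_pnorm_le1 {R : realType} (p : R) {m n : nat} (Z : 'M[R]_(m, n))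
    u1 u2 v t : 2 < p -> P_feasible p Z u1 u2 v t -> v_pnorm p Z <= 1.
Proof.
move=> p2 [hu [K1 [K2 D0]]]; apply: v_pnorm_le => [|X [X1 [X2 Xpsd]]]; first by lra.
(* [u1] is only known to be nonnegative if [m > 0], and [u2] if [n > 0]. *)
case: m Z v t hu K1 K2 D0 X X1 X2 Xpsd => [|m] Z v t hu K1 K2 D0 X X1 X2 Xpsd.
  by rewrite (frob_sym_block _ _ Xpsd.1) big_ord0.
case: n Z v t hu K1 K2 D0 X X1 X2 Xpsd => [|n] Z v t hu K1 K2 D0 X X1 X2 Xpsd.
  by rewrite (frob_sym_block _ _ Xpsd.1) big1// => i _; rewrite big_ord0.
have := frob_psd_ge0 _ _ D0 Xpsd; rewrite frobBl subr_ge0 => /le_trans; apply.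
rewrite frob_diag big_split_ord /=; apply: le_trans hu.
have X0 i := psd_diag_ge0 X i Xpsd.
have bound k (u : R) (f : 'I_k -> 'I_(m.+1 + n.+1)) : 0 <= u ->
    (forall i, Kp3 p (v 0 (f i)) u (t 0 (f i))) ->
    \sum_i `|X (f i) (f i)| `^ (p / 2) <= 1 ->
    \sum_i v 0 (f i) * X (f i) (f i) <= u + theta p * \sum_i t 0 (f i).
  move=> u0 hK hs.
  apply: (@le_trans _ _ (u * \sum_i `|X (f i) (f i)| `^ (p / 2) + theta p * \sum_i t 0 (f i))).
    rewrite !mulr_sumr -big_split /=; apply: ler_sum => i _.
    by rewrite ger0_norm//; apply: Kp3_young.
  by rewrite lerD2r ler_piMr.
rewrite big_split_ord mulrDr addrACA lerD//=.
  by apply: bound (K1) X1; exact: (K1 ord0).1.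
by apply: bound (K2) X2; exact: (K2 ord0).1.
Qed.

Lemma lnorm_v_feasible {R : realType} (p : R) {m n : nat} (X : 'M[R]_(m + n)) : 0 < p ->
  v_feasible p X <-> [/\ lnorm (p / 2) (fun i => X (lshift n i) (lshift n i)) <= 1,
    lnorm (p / 2) (fun j => X (rshift m j) (rshift m j)) <= 1 & psd X].
Proof.
move=> p0; have r0 : 0 < p / 2 by rewrite divr_gt0.
by rewrite /v_feasible !lnorm_le1//; split=> [[? [? ?]]|[? ? ?]].
Qed.

Lemma frob_row {R : realType} {k : nat} (v c : 'rV[R]_k) : frob v c = \sum_i v 0 i * c 0 i.
Proof. by rewrite /frob big_ord1. Qed.

Lemma delta_colE {R : realType} {k : nat} (i j : 'I_k) :
  (delta_mx i 0 : 'cV[R]_k) j 0 = (j == i)%:R.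
Proof. by rewrite mxE andbT. Qed.

Lemma lnorm_coords_sublinear {R : realType} (r : R) {k l : nat} (f : 'I_k -> 'I_l) :
  1 < r -> sublinear (fun d : 'rV[R]_l => lnorm r (fun i => d 0 (f i))).
Proof.
move=> r1; have r0 : 0 < r by exact: lt_trans r1.
split=> [|x y|t x t0].
- by rewrite -[RHS](@lnorm0 R r k r0); congr lnorm; apply/funext => i; rewrite mxE.
- apply: le_trans (lnormD r _ _ r1); rewrite le_eqVlt; apply/predU1P; left.
  by congr lnorm; apply/funext => i; rewrite mxE.
- rewrite -(lnormZ r t _ r0 (ltW t0)) le_eqVlt; apply/predU1P; left.
  by congr lnorm; apply/funext => i; rewrite mxE.
Qed.

Lemma sublinear_max {R : realType} {V : lmodType R} (p q : V -> R) :
  sublinear p -> sublinear q -> sublinear (fun x => Num.max (p x) (q x)).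
Proof.
move=> [p0 pD pZ] [q0 qD qZ]; split=> [|x y|t x t0]; first by rewrite p0 q0 maxxx.
- rewrite ge_max; apply/andP; split.
    by apply: le_trans (pD x y) _; rewrite lerD// le_max lexx.
  by apply: le_trans (qD x y) _; rewrite lerD// le_max lexx orbT.
- rewrite ge_max; apply/andP; split.
    by apply: le_trans (pZ t x t0) _; rewrite ler_pM2l// le_max lexx.
  by apply: le_trans (qZ t x t0) _; rewrite ler_pM2l// le_max lexx orbT.
Qed.

(* Separating the cone of all [(diag X, <sym_block Z, X>)], [X] psd, from the
   gauge of the diagonal constraints yields the dual variable [v]. *)
Lemma v_pnorm_le1_P_feasible {R : realType} (p : R) {m n : nat} (Z : 'M[R]_(m, n)) :
  2 < p -> v_pnorm p Z <= 1 -> exists u1 u2 v t, P_feasible p Z u1 u2 v t.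
Proof.
move=> p2 vZ; have p0 : 0 < p by lra.
have r1 : 1 < p / 2 by lra.
have r0 : 0 < p / 2 by lra.
pose N1 (d : 'rV[R]_(m + n)) := lnorm (p / 2) (fun i : 'I_m => d 0 (lshift n i)).
pose N2 (d : 'rV[R]_(m + n)) := lnorm (p / 2) (fun j : 'I_n => d 0 (rshift m j)).
have sN : sublinear (fun d => Num.max (N1 d) (N2 d)).
  by apply: sublinear_max; exact: lnorm_coords_sublinear.
pose dg (X : 'M[R]_(m + n)) : 'rV[R]_(m + n) := \row_i X i i.
pose C c s := exists X, [/\ psd X, c = dg X & s = frob (sym_block Z) X].
have cC : graph_cone C.
  split.
  - exists 0; split; [exact: psd0| |by rewrite frob0r].
    by apply/rowP => i; rewrite !mxE.
  - move=> c s c' s' [X [X0 -> ->]] [Y [Y0 -> ->]]; exists (X + Y).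
    split; [exact: psdD| |by rewrite frobDr].
    by apply/rowP => i; rewrite !mxE.
  - move=> t c s t0 [X [X0 -> ->]]; exists (t *: X).
    split; [exact: psdZ (ltW t0) X0| |by rewrite frobZr].
    by apply/rowP => i; rewrite !mxE.
have Cle c s : C c s -> s <= Num.max (N1 c) (N2 c).
  move=> [X [X0 -> ->]]; apply/ler_addgt0Pr => e e0.
  (* Adding [e] makes [M] positive, so that [M^-1 *: X] is feasible even if the diagonal
     vanishes. *)
  set M := Num.max _ _ + e.
  have le1 : N1 (dg X) <= M by rewrite /M; apply: (ler_wpDr (ltW e0)); rewrite le_max lexx.
  have le2 : N2 (dg X) <= M by rewrite /M; apply: (ler_wpDr (ltW e0)); rewrite le_max lexx orbT.
  have M0 : 0 < M by apply: ltr_wpDl e0; rewrite le_max lnorm_ge0.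
  have Mi : 0 <= M^-1 by rewrite invr_ge0; exact: ltW.
  have bound k (f : 'I_k -> 'I_(m + n)) : lnorm (p / 2) (fun i => dg X 0 (f i)) <= M ->
      lnorm (p / 2) (fun i => M^-1 * dg X 0 (f i)) <= 1.
    move=> h; rewrite (lnormZ (p / 2) M^-1 (fun i => dg X 0 (f i)) r0 Mi).
    by rewrite ler_pdivrMl// mulr1.
  have : frob (sym_block Z) (M^-1 *: X) <= 1.
    apply: le_trans _ vZ; apply: frob_le_v_pnorm => //.
    apply/lnorm_v_feasible => //; split; last exact: psdZ.
    + apply: le_trans (bound _ (lshift n) le1).
      by rewrite le_eqVlt; apply/predU1P; left; congr lnorm; apply/funext => i; rewrite !mxE.
    + apply: le_trans (bound _ (@rshift m n) le2).
      by rewrite le_eqVlt; apply/predU1P; left; congr lnorm; apply/funext => i; rewrite !mxE.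
  by rewrite frobZr ler_pdivrMl// mulr1.
have [v [vN vC]] := matrix_hahn_banach _ C sN cC Cle.
have quad (x : 'cV[R]_(m + n)) :
    (x^T *m sym_block Z *m x) 0 0 <= \sum_i v 0 i * x i 0 ^+ 2.
  have := vC (dg (x *m x^T)) _ (ex_intro _ _ (And3 (psd_outer x) erefl erefl)).
  rewrite frob_outer frob_row => /le_trans; apply.
  by apply: ler_sum => i _; rewrite !mxE big_ord1 mxE expr2.
(* Tested on the outer square of a unit vector, whose off-diagonal block is zero. *)
have v0 i : 0 <= v 0 i.
  pose e : 'cV[R]_(m + n) := delta_mx i 0.
  have := vC (dg (e *m e^T)) _ (ex_intro _ _ (And3 (psd_outer e) erefl erefl)).
  have E k l : (e *m e^T) k l = (k == i)%:R * (l == i)%:R.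
    by rewrite mxE big_ord1 delta_colE [_^T _ _]mxE delta_colE.
  rewrite frob_sym_block; last by rewrite trmx_mul trmxK.
  rewrite big1; last first.
    move=> k _; rewrite big1// => l _; rewrite E.
    have [<-|] := eqVneq (lshift n k) i; last by rewrite mul0r mulr0.
    by rewrite -(inj_eq val_inj) /= gtn_eqF ?mulr0//; apply: ltn_addr; exact: ltn_ord.
  rewrite frob_row (bigD1 i)//= big1 => [|k ki]; last by rewrite mxE E (negPf ki) mul0r mulr0.
  by rewrite mxE E eqxx !mulr1 addr0.
have q_eq : p / (p - 2) = (p / 2) / (p / 2 - 1) by field; rewrite !gt_eqF; lra.
have [d1 [d1n d1E]] := lnorm_dual (p / 2) (fun i : 'I_m => v 0 (lshift n i)) r1 (fun i => v0 _).
have [d2 [d2n d2E]] := lnorm_dual (p / 2) (fun j : 'I_n => v 0 (rshift m j)) r1 (fun i => v0 _).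
have [u1 [t1 [K1 h1]]] := Kp3_lnorm p (fun i : 'I_m => v 0 (lshift n i)) p2 (fun i => v0 _).
have [u2 [t2 [K2 h2]]] := Kp3_lnorm p (fun j : 'I_n => v 0 (rshift m j)) p2 (fun i => v0 _).
have sum1 : lnorm (p / (p - 2)) (fun i : 'I_m => v 0 (lshift n i)) +
    lnorm (p / (p - 2)) (fun j : 'I_n => v 0 (rshift m j)) <= 1.
  (* The two norming vectors, glued together, have gauge at most 1, because the gauge is a maximum;
     the functional [v] takes on them the sum of the two dual norms. *)
  pose d : 'rV[R]_(m + n) := row_mx (\row_i d1 i) (\row_j d2 j).
  have := vN d; rewrite frob_row big_split_ord /=.
  rewrite q_eq -d1E -d2E => /le_trans h; apply: le_trans (h 1 _).
    by apply: lerD; apply: ler_sum => i _; rewrite ?row_mxEl ?row_mxEr mxE.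
  rewrite ge_max; apply/andP; split.
    rewrite /N1 (_ : (fun _ => _) = d1)//; apply/funext => i; by rewrite row_mxEl mxE.
  rewrite /N2 (_ : (fun _ => _) = d2)//; apply/funext => i; by rewrite row_mxEr mxE.
exists u1, u2, v, (row_mx (\row_i t1 i) (\row_j t2 j)); split.
  rewrite big_split_ord /=.
  under eq_bigr do rewrite row_mxEl mxE.
  under [X in _ * (_ + X)]eq_bigr do rewrite row_mxEr mxE.
  by rewrite mulrDr addrACA; exact: le_trans (lerD h1 h2) sum1.
split; first by move=> i; rewrite row_mxEl mxE.
split; first by move=> i; rewrite row_mxEr mxE.
split; first by rewrite linearB /= tr_diag_mx sym_block_tr.
move=> x; rewrite mulmxBr mulmxBl -scaleN1r addmxE scalemxE mulN1r subr_ge0.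
apply: le_trans (quad x) _; rewrite -frob_outer frob_diag.
by apply: ler_sum => i _; rewrite mxE big_ord1 mxE expr2.
Qed.

(** * The nuclear norm and its comparison with the v-norm *)

Lemma outer_le_v_pnorm {R : realType} (p : R) {m n : nat} (Z : 'M[R]_(m, n))
    (x : 'cV[R]_m) (y : 'cV[R]_n) : 0 < p -> pnorm p x <= 1 -> pnorm p y <= 1 ->
  (x^T *m Z *m y) 0 0 <= v_pnorm p Z.
Proof.
move=> p0 hx hy; pose X := col_mx x y *m (col_mx x y)^T.
have XE i j : X i j = col_mx x y i 0 * col_mx x y j 0.
  by rewrite mxE big_ord1 [X in _ * X]mxE.
have -> : (x^T *m Z *m y) 0 0 = frob (sym_block Z) X.
  rewrite frob_sym_block; last exact: (psd_outer _).1.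
  rewrite -frob_outer; apply: eq_bigr => i _; apply: eq_bigr => j _.
  by rewrite XE col_mxEu col_mxEd mxE big_ord1 mxE.
have sqr_powR (z : R) : `|z * z| `^ (p / 2) = `|z| `^ p.
  rewrite -expr2 normrX -powR_mulrn// -powRrM; congr (_ `^ _); by field.
apply: frob_le_v_pnorm => //; split; [|split; [|exact: psd_outer]].
  move: hx; rewrite pnormE lnorm_le1//; apply: le_trans.
  by apply: ler_sum => i _; rewrite XE !col_mxEu sqr_powR.
move: hy; rewrite pnormE lnorm_le1//; apply: le_trans.
by apply: ler_sum => i _; rewrite XE !col_mxEd sqr_powR.
Qed.

Lemma pnormZ {R : realType} (p c : R) {k : nat} (x : 'cV[R]_k) : 0 < p -> 0 <= c ->
  pnorm p (c *: x) = c * pnorm p x.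
Proof.
move=> p0 c0; rewrite !pnormE -(lnormZ p c _ p0 c0).
by congr lnorm; apply/funext => i; rewrite mxE.
Qed.

Lemma pnormN {R : realType} (p : R) {k : nat} (x : 'cV[R]_k) : pnorm p (- x) = pnorm p x.
Proof. by rewrite /pnorm; under eq_bigr do rewrite mxE normrN. Qed.

Lemma pnorm_delta {R : realType} (p : R) {k : nat} (i : 'I_k) : 0 < p ->
  pnorm p (delta_mx i 0 : 'cV[R]_k) = 1.
Proof.
move=> p0; rewrite /pnorm (bigD1 i)//= big1 => [|j ji].
  by rewrite delta_colE eqxx normr1 powR1 addr0 powR1.
by rewrite delta_colE (negPf ji) normr0 powR0 ?gt_eqF.
Qed.

(** Arbitrary finite index types let decompositions be joined over a sum type and entries be indexed
    by pairs. *)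
Definition nuc_values {R : realType} (p : R) {m n : nat} (A : 'M[R]_(m, n)) : set R :=
  [set s | exists (I : finType) (lam : I -> R) (x : I -> 'cV[R]_m) (y : I -> 'cV[R]_n),
     [/\ forall k, pnorm p (x k) = 1, forall k, pnorm p (y k) = 1,
       A = \sum_k lam k *: (x k *m (y k)^T) & s = \sum_k `|lam k|]]%classic.

Lemma nuc_pnormE {R : realType} (p : R) {m n : nat} (A : 'M[R]_(m, n)) :
  nuc_pnorm p A = inf (nuc_values p A).
Proof.
congr inf; apply/seteqP; split=> [s [r [lam [x [y [hx [hy [-> ->]]]]]]]|s].
  by exists 'I_r, lam, x, y.
move=> [I [lam [x [y [hx hy -> ->]]]]].
exists #|I|, (lam \o enum_val), (x \o enum_val), (y \o enum_val).
split=> [k|]; first exact: hx.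
split=> [k|]; first exact: hy.
by split; rewrite sum_enum_val.
Qed.

Lemma nuc_values_neq0 {R : realType} (p : R) {m n : nat} (A : 'M[R]_(m, n)) :
  0 < p -> (nuc_values p A !=set0)%classic.
Proof.
move=> p0; exists (\sum_(k : 'I_m * 'I_n) `|A k.1 k.2|).
exists ('I_m * 'I_n)%type, (fun k => A k.1 k.2), (fun k => delta_mx k.1 0),
  (fun k => delta_mx k.2 0); split=> // [k|k|]; try exact: pnorm_delta.
rewrite {1}(matrix_sum_delta A) pair_bigA; apply: eq_bigr => k _.
by rewrite trmx_delta mul_delta_mx.
Qed.

Lemma nuc_values_ge0 {R : realType} (p : R) {m n : nat} (A : 'M[R]_(m, n)) s :
  nuc_values p A s -> 0 <= s.
Proof. by move=> [I [lam [x [y [_ _ _ ->]]]]]; exact: sumr_ge0. Qed.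

Lemma nuc_pnorm_le {R : realType} (p : R) {m n : nat} (A : 'M[R]_(m, n)) s :
  nuc_values p A s -> nuc_pnorm p A <= s.
Proof.
by move=> h; rewrite nuc_pnormE; apply: ge_inf h; exists 0 => z; exact: nuc_values_ge0.
Qed.

Lemma le_nuc_pnorm {R : realType} (p : R) {m n : nat} (A : 'M[R]_(m, n)) b : 0 < p ->
  (forall s, nuc_values p A s -> b <= s) -> b <= nuc_pnorm p A.
Proof. by move=> p0 h; rewrite nuc_pnormE; apply: lb_le_inf h; exact: nuc_values_neq0. Qed.

Lemma nuc_pnorm_sublinear {R : realType} (p : R) {m n : nat} : 0 < p ->
  sublinear (@nuc_pnorm R p m n).
Proof.
move=> p0; split.
- apply/eqP; rewrite eq_le; apply/andP; split.
    apply: nuc_pnorm_le; exists void, (fun=> 0), (fun=> 0), (fun=> 0).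
    by split=> [[]|[]||]; rewrite big1// => -[].
  by apply: le_nuc_pnorm => // s; exact: nuc_values_ge0.
- move=> A B; rewrite -lerBlDr; apply: le_nuc_pnorm => // s hs.
  rewrite lerBlDr -lerBlDl; apply: le_nuc_pnorm => // s' hs'; rewrite lerBlDl.
  apply: nuc_pnorm_le.
  move: hs hs' => [I [lam [x [y [hx hy -> ->]]]]] [J [mu [z [w [hz hw -> ->]]]]].
  exists (I + J)%type, (fun k => match k with inl i => lam i | inr j => mu j end),
    (fun k => match k with inl i => x i | inr j => z j end),
    (fun k => match k with inl i => y i | inr j => w j end).
  by split=> [[]|[]||] //; rewrite big_sumType.
- move=> t A t0; rewrite mulrC -ler_pdivrMr//; apply: le_nuc_pnorm => // s hs.
  rewrite ler_pdivrMr//; apply: nuc_pnorm_le.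
  move: hs => [I [lam [x [y [hx hy -> ->]]]]].
  exists I, (fun k => t * lam k), x, y; split=> //.
    by rewrite scaler_sumr; apply: eq_bigr => k _; rewrite scalerA.
  by rewrite mulr_suml; apply: eq_bigr => k _; rewrite normrM (gtr0_norm t0) mulrC.
Qed.

(** The product of the two norms moves into the coefficient; a zero vector cannot be normalised, but
    then the matrix is 0. *)
Lemma nuc_pnorm_outer_le1 {R : realType} (p : R) {m n : nat} (x : 'cV[R]_m)
    (y : 'cV[R]_n) : 0 < p -> pnorm p x <= 1 -> pnorm p y <= 1 ->
  nuc_pnorm p (x *m y^T) <= 1.
Proof.
move=> p0 hx hy.
have pnorm_eq0 k (z : 'cV[R]_k) : pnorm p z = 0 -> z = 0.
  by rewrite pnormE => /(lnorm_eq0 p _ p0) h; apply/colP => i; rewrite h mxE.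
have normalize k (z : 'cV[R]_k) : 0 < pnorm p z -> pnorm p ((pnorm p z)^-1 *: z) = 1.
  by move=> z0; rewrite pnormZ ?invr_ge0 ?(ltW z0)// mulVf// gt_eqF.
have x0 : 0 <= pnorm p x by rewrite pnormE lnorm_ge0.
have y0 : 0 <= pnorm p y by rewrite pnormE lnorm_ge0.
have := x0; rewrite le_eqVlt => /predU1P[/esym/pnorm_eq0 ->|xp].
  by rewrite mul0mx (sublinear0 _ (nuc_pnorm_sublinear p p0)).
have := y0; rewrite le_eqVlt => /predU1P[/esym/pnorm_eq0 ->|yp].
  by rewrite trmx0 mulmx0 (sublinear0 _ (nuc_pnorm_sublinear p p0)).
apply: le_trans (mulr_ile1 x0 y0 hx hy); apply: nuc_pnorm_le.
exists unit, (fun=> pnorm p x * pnorm p y), (fun=> (pnorm p x)^-1 *: x),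
  (fun=> (pnorm p y)^-1 *: y); split=> [_|_||]; try exact: normalize.
  rewrite big_const card_unit /= addr0 linearZ /= -scalemxAl -scalemxAr !scalerA.
  move: (pnorm p x) (pnorm p y) xp yp => a b a0 b0.
  by rewrite [X in X *: _](_ : _ = 1) ?scale1r//; field; rewrite !gt_eqF.
by rewrite big_const card_unit /= addr0 ger0_norm// mulr_ge0.
Qed.

Lemma frob_le_nuc_pnorm {R : realType} (p : R) {m n : nat} (A Z : 'M[R]_(m, n)) : 0 < p ->
  v_pnorm p Z <= 1 -> frob A Z <= nuc_pnorm p A.
Proof.
move=> p0 vZ; apply: le_nuc_pnorm => // s [I [lam [x [y [hx hy -> ->]]]]].
rewrite frobC frob_sumr; apply: ler_sum => k _; rewrite frobZr frob_outer.
apply: le_trans (ler_norm _) _; rewrite normrM ler_piMr// ler_norml.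
(* Using both [x k] and [- x k] bounds the absolute value of the bilinear form, whatever the sign of
   [lam k]. *)
have h1 := outer_le_v_pnorm p Z (- x k) (y k) p0.
have h2 := outer_le_v_pnorm p Z (x k) (y k) p0.
rewrite pnormN linearN /= !mulNmx [X in _ -> _ -> X <= _]mxE hx hy in h1.
rewrite hx hy in h2; have := h1 (lexx 1) (lexx 1); have := h2 (lexx 1) (lexx 1).
by move=> {}h2 {}h1; rewrite lerNl (le_trans h1 vZ) (le_trans h2 vZ).
Qed.

(** Grothendieck bounds ask for exact unit vectors, so a zero row is assigned an arbitrary one; this
    is why the dimension must be positive. *)
Lemma unit_row_decomposition {R : realType} {d : nat} (b : 'rV[R]_d.+1) :
  exists x : 'rV[R]_d.+1, (x *m x^T) 0 0 = 1 /\ b = Num.sqrt ((b *m b^T) 0 0) *: x.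
Proof.
set s := (b *m b^T) 0 0.
have sE : s = \sum_k b 0 k ^+ 2 by rewrite /s row_mul_trE.
have s0 : 0 <= s by rewrite sE; apply: sumr_ge0 => k _; exact: sqr_ge0.
have [sz|sn0] := eqVneq s 0.
  exists (delta_mx 0 0); split.
    by rewrite trmx_delta mul_delta_mx mxE.
  rewrite sz sqrtr0 scale0r; apply/rowP => k; rewrite mxE; apply/eqP.
  rewrite -sqrf_eq0; move: sz; rewrite sE => /eqP.
  rewrite psumr_eq0 => [/allP/(_ k (mem_index_enum k))//|l _]; exact: sqr_ge0.
have sp : 0 < s by rewrite lt_neqAle eq_sym sn0.
have q0 : Num.sqrt s != 0 by rewrite gt_eqF// sqrtr_gt0.
exists ((Num.sqrt s)^-1 *: b); split; last by rewrite scalerA mulfV// scale1r.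
rewrite linearZ /= -scalemxAl -scalemxAr scalerA scalemxE -/s -invfM -expr2.
by rewrite sqr_sqrtr// mulVf.
Qed.

(* Factoring [X = B B^T] and normalising the rows of [B] turns <sym_block Z, X> into
   a Grothendieck sum for the coefficients [Z i j * sqrt X_ii * sqrt X_jj], whose
   sign_max is a value of [Z] on rank one matrices of unit nuclear norm. *)
Lemma v_pnorm_le_grothendieck {R : realType} (p : R) {m n : nat} (Z : 'M[R]_(m, n)) :
  0 < p -> (forall B, frob Z B <= nuc_pnorm p B) -> v_pnorm p Z <= grothendieck_const R.
Proof.
move=> p0 hZ; have G1 := grothendieck_const_ge1 R.
have G0 : 0 <= grothendieck_const R by apply: le_trans G1.
apply: v_pnorm_le => // X [X1 [X2 Xpsd]]; rewrite (frob_sym_block _ _ Xpsd.1).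
have [m0|m0] := posnP m.
  by rewrite big1// => i; have := ltn_ord i; rewrite {2}m0.
have [B XB] := psd_gram _ Xpsd.
have [d dE] : exists d, (m + n)%N = d.+1 by exists (m + n).-1; rewrite prednK// addn_gt0 m0.
have XE i j : X i j = (row i B *m (row j B)^T) 0 0.
  by rewrite XB row_mul_trE mxE; apply: eq_bigr => k _; rewrite !mxE.
have /choice[w hw] : forall i, exists x : 'rV[R]_(m + n),
    (x *m x^T) 0 0 = 1 /\ row i B = Num.sqrt (X i i) *: x.
  move=> i; rewrite XE; move: (row i B); rewrite dE; exact: unit_row_decomposition.
pose a i := Num.sqrt (X (lshift n i) (lshift n i)).
pose b j := Num.sqrt (X (rshift m j) (rshift m j)).
pose T : 'M[R]_(m, n) := \matrix_(i, j) (Z i j * a i * b j).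
have -> : \sum_i \sum_j Z i j * X (lshift n i) (rshift m j) =
    \sum_i \sum_j T i j * (w (lshift n i) *m (w (rshift m j))^T) 0 0.
  apply: eq_bigr => i _; apply: eq_bigr => j _.
  rewrite XE (hw (lshift n i)).2 (hw (rshift m j)).2 linearZ /= -scalemxAl -scalemxAr.
  by rewrite !scalemxE [T _ _]mxE /a /b; ring.
apply: le_trans (grothendieck_const_bound R _ _ _ T _ _ (fun i => (hw _).1) (fun j => (hw _).1)) _.
rewrite ger_pMr; last by apply: lt_le_trans G1.
apply: sign_max_le => e f he hf.
pose x : 'cV[R]_m := \col_i (a i * e i); pose y : 'cV[R]_n := \col_j (b j * f j).
have -> : \sum_i \sum_j T i j * e i * f j = frob Z (x *m y^T).
  apply: eq_bigr => i _; apply: eq_bigr => j _.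
  by rewrite [in RHS]mxE big_ord1 !mxE; ring.
apply: le_trans (hZ _) _.
have sgn (z : R) : z = 1 \/ z = -1 -> `|z| = 1 by case=> ->; rewrite ?normrN normr1.
have sqrt_powR i : Num.sqrt (X i i) `^ p = `|X i i| `^ (p / 2).
  rewrite ger0_norm; last exact: psd_diag_ge0.
  rewrite -powR12_sqrt; last exact: psd_diag_ge0.
  by rewrite -powRrM mulrC.
apply: nuc_pnorm_outer_le1 => //.
- rewrite pnormE lnorm_le1//; apply: le_trans X1.
  apply: ler_sum => i _.
  by rewrite mxE normrM (sgn _ (he i)) mulr1 ger0_norm ?sqrtr_ge0// sqrt_powR.
- rewrite pnormE lnorm_le1//; apply: le_trans X2.
  apply: ler_sum => i _.
  by rewrite mxE normrM (sgn _ (hf i)) mulr1 ger0_norm ?sqrtr_ge0// sqrt_powR.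
Qed.

(** * The u-norm against the nuclear and spectral norms *)

Lemma v_pnormZ_le {R : realType} (p t b : R) {m n : nat} (Z : 'M[R]_(m, n)) : 0 < p ->
  0 <= t -> v_pnorm p Z <= b -> v_pnorm p (t *: Z) <= t * b.
Proof.
move=> p0 t0 h; apply: v_pnorm_le => // X hX.
have -> : sym_block (t *: Z) = t *: sym_block Z.
  by rewrite /sym_block scale_block_mx !scaler0 [(t *: Z)^T]linearZ /= !scalerA (mulrC t).
rewrite frobZl ler_wpM2l//; apply: le_trans h; exact: frob_le_v_pnorm.
Qed.

Lemma v_pnorm0_le1 {R : realType} (p : R) {m n : nat} : 0 < p ->
  v_pnorm p (0 : 'M[R]_(m, n)) <= 1.
Proof.
move=> p0; apply: v_pnorm_le => // X hX.
by rewrite /sym_block trmx0 !scaler0 block_mx0 frobC frob0r.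
Qed.

Lemma frob_le_u_pnorm {R : realType} (p : R) {m n : nat} (A Z : 'M[R]_(m, n)) : 0 < p ->
  v_pnorm p Z <= 1 -> frob A Z <= u_pnorm p A.
Proof.
move=> p0 hZ; apply: ub_le_sup; last by exists Z.
by exists (nuc_pnorm p A) => s [Y [hY ->]]; exact: frob_le_nuc_pnorm.
Qed.

Lemma u_pnorm_le_nuc_pnorm {R : realType} (p : R) {m n : nat} (A : 'M[R]_(m, n)) :
  0 < p -> u_pnorm p A <= nuc_pnorm p A.
Proof.
move=> p0; apply: ge_sup; first by exists (frob A 0), 0; rewrite v_pnorm0_le1.
by move=> s [Z [hZ ->]]; exact: frob_le_nuc_pnorm.
Qed.

Lemma nuc_pnorm_le_grothendieck {R : realType} (p : R) {m n : nat} (A : 'M[R]_(m, n)) :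
  0 < p -> nuc_pnorm p A <= grothendieck_const R * u_pnorm p A.
Proof.
move=> p0; have G0 : 0 < grothendieck_const R.
  by apply: lt_le_trans (grothendieck_const_ge1 R).
have sN := @nuc_pnorm_sublinear R p m n p0.
(* The ray through [A] at the height of the norm: separation along it yields a functional supporting
   the norm at [A]. *)
pose C c s := exists t, [/\ 0 <= t, c = t *: A & s = t * nuc_pnorm p A].
have cC : graph_cone C.
  split.
  - by exists 0; rewrite scale0r mul0r.
  - move=> c s c' s' [t [t0 -> ->]] [t' [t'0 -> ->]]; exists (t + t').
    by rewrite addr_ge0 // scalerDl mulrDl.
  - move=> t c s t0 [t' [t'0 -> ->]]; exists (t * t').
    by rewrite scalerA mulrA mulr_ge0 // ltW.
have Cp c s : C c s -> s <= nuc_pnorm p c.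
  by move=> [t [t0 -> ->]]; exact: sublinear_le_scale.
have [Z [hZ ZC]] := matrix_hahn_banach _ C sN cC Cp.
have ZA : nuc_pnorm p A <= frob Z A by apply: ZC; exists 1; rewrite scale1r mul1r.
apply: le_trans ZA _; rewrite frobC -ler_pdivrMl// -frobZr.
apply: frob_le_u_pnorm => //; rewrite -(@mulVf _ (grothendieck_const R)) ?gt_eqF//.
apply: v_pnormZ_le => //; first by rewrite invr_ge0 ltW.
exact: v_pnorm_le_grothendieck.
Qed.

Lemma spec_pnorm_le_v_pnorm {R : realType} (p : R) {m n : nat} (Z : 'M[R]_(m, n)) b :
  0 < p -> 0 <= b -> v_pnorm p Z <= b -> spec_pnorm p Z <= b.
Proof.
move=> p0 b0 hb; rewrite /spec_pnorm; set S := (X in sup X).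
(* With an empty dimension there are no unit vectors and the supremum defaults to 0, hence the
   hypothesis [0 <= b]. *)
have [->|/set0P S0] := eqVneq S set0; first by rewrite sup0.
apply: ge_sup => // s [x [y [hx [hy ->]]]].
by apply: le_trans hb; apply: outer_le_v_pnorm; rewrite ?hx ?hy.
Qed.

Theorem theorem3p8 (R : realType) (m n : nat) (A : 'M[R]_(m, n)) (p : rat) :
  2 < p ->
  let pR : R := ratr p in
  u_pnorm pR A = P_value pR A /\
  u_pnorm pR A <= nuc_pnorm pR A /\
  nuc_pnorm pR A <= grothendieck_const R * u_pnorm pR A /\
  (forall (Z : 'M[R]_(m, n)) (u1 u2 : R) (v t : 'rV[R]_(m + n)),
     P_optimal pR A Z u1 u2 v t ->
     spec_pnorm pR Z <= 1 /\ nuc_pnorm pR A / grothendieck_const R <= frob A Z).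
Proof.
move=> p2 pR.
have pR2 : 2 < pR by rewrite -[2](ratr_nat R 2) ltr_rat.
have p0 : 0 < pR by apply: lt_trans pR2.
have valueE : u_pnorm pR A = P_value pR A.
  congr sup; apply/seteqP; split=> s [Z].
    move=> [/(v_pnorm_le1_P_feasible pR Z pR2)[u1 [u2 [v [t hP]]]] ->].
    by exists Z, u1, u2, v, t.
  move=> [u1 [u2 [v [t [hP ->]]]]]; exists Z; split=> //.
  exact: P_feasible_v_pnorm_le1 pR2 hP.
split=> //; split; first exact: u_pnorm_le_nuc_pnorm.
have nucG := nuc_pnorm_le_grothendieck pR A p0.
split=> // Z u1 u2 v t [hP ->].
split.
  apply: spec_pnorm_le_v_pnorm p0 ler01 _; exact: P_feasible_v_pnorm_le1 pR2 hP.
rewrite -valueE ler_pdivrMr; first by rewrite mulrC.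
by apply: lt_le_trans (grothendieck_const_ge1 R).
Qed.
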